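(* Let $T\subset\mathbb{R}^3$ be a (nondegenerate) tetrahedron. For $k=2,3$, $$\operatorname{div}\boldsymbol{\mathfrak{B}}_{k+1}(T)=P_{0,k}^{\perp}(T).$$
   Context: $P_m(S)$ denotes the space of real polynomials of degree at most $m$ on $S$ (for $S$ a tetrahedron or a triangular face). $\mathcal{F}(T)$ is the set of the four faces of $T$. The scalar bubble function space is $$\mathfrak{B}_{k+1}(T)=\Big\{v\in P_{k+1}(T)\ \Big|\ \int_F v\,q\,ds=0\ \text{ for all } q\in P_{k-1}(F),\ F\in\mathcal{F}(T)\Big\},$$ and $\boldsymbol{\mathfrak{B}}_{k+1}(T)=\mathfrak{B}_{k+1}(T)\times\mathfrak{B}_{k+1}(T)\times\mathfrak{B}_{k+1}(T)$ is the space of vector fields with components in it; $\operatorname{div}\boldsymbol{\mathfrak{B}}_{k+1}(T)$ is its image under the divergence. $P_{0,k}^{\perp}(T)$ is the $L^2(T)$-orthogonal complement of the constants $P_0(T)$ in $P_k(T)$, i.e. $\{q\in P_k(T):\int_T q\,dx=0\}$. *)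

(* Defs.v *)
(* Libraries: MathComp, MathComp-Analysis and multinomials.  The latter is
   imported without its notations, which clash with those of MathComp-Analysis. *)
From HB Require Import structures.
From mathcomp Require Import all_boot all_order all_algebra.
From mathcomp Require Import all_classical all_reals all_analysis.
From mathcomp Require mpoly.
Import -(notations) mpoly.

Set Implicit Arguments.
Unset Strict Implicit.
Unset Printing Implicit Defensive.

Import Order.TTheory GRing.Theory Num.Theory.

Local Open Scope classical_set_scope.
Local Open Scope ring_scope.

(* Real polynomials in the three coordinates of R^3.  A polynomial on a
   tetrahedron is identified with the formal polynomial inducing it (a
   nondegenerate tetrahedron has nonempty interior); a polynomial on a face is
   the restriction of a polynomial of the same degree bound. *)
Notation poly3 R := (mpoly.mpoly 3 R).

Section Tetrahedron.
Variable R : realType.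

(* [msize p] is the total degree plus one, and [msize 0 = 0]. *)
Definition Pdeg (m : nat) : set (poly3 R) :=
  [set p | (msize p <= m.+1)%N].

Definition peval (p : poly3 R) (x : 'rV[R]_3) : R :=
  meval (fun i => x ord0 i) p.

Definition divergence (v : 'I_3 -> poly3 R) : poly3 R :=
  \sum_(i < 3) mderiv i (v i).

(* MathComp-Analysis has product measures on R * R * R, not on row vectors. *)
Definition pt3 (x : R * R * R) : 'rV[R]_3 :=
  \row_(i < 3) [:: x.1.1; x.1.2; x.2]`_i.

(* A tetrahedron is given by the 4 x 3 matrix whose rows are its vertices. *)
Definition nondegenerate_tet (V : 'M[R]_(4, 3)) : bool :=
  row_free (\matrix_(i < 3) (row (lift ord0 i) V - row ord0 V)).

Definition tetrahedron (V : 'M[R]_(4, 3)) : set 'rV[R]_3 :=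
  [set x | exists l : 'I_4 -> R,
     [/\ forall i, 0 <= l i, \sum_(i < 4) l i = 1 &
         x = \sum_(i < 4) l i *: row i V]].

Definition integral_tet (V : 'M[R]_(4, 3)) (q : poly3 R) : R :=
  Rintegral (lebesgue_measure \x lebesgue_measure \x lebesgue_measure)%E
    (pt3 @^-1` tetrahedron V) (fun x => peval q (pt3 x)).

(* The face with index [f] is the one opposite to vertex [f]; its vertices are
   the vertices [lift f j] for [j < 3]. *)
Definition face_vertex (V : 'M[R]_(4, 3)) (f : 'I_4) (j : 'I_3) : 'rV[R]_3 :=
  row (lift f j) V.

Definition face_edges (V : 'M[R]_(4, 3)) (f : 'I_4) : 'M[R]_(2, 3) :=
  \matrix_(j < 2) (face_vertex V f (lift ord0 j) - face_vertex V f ord0).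

Definition reference_triangle : set (R * R) :=
  [set u | [/\ 0 <= u.1, 0 <= u.2 & u.1 + u.2 <= 1]].

Definition face_param (V : 'M[R]_(4, 3)) (f : 'I_4) (u : R * R) : 'rV[R]_3 :=
  face_vertex V f ord0 + u.1 *: row ord0 (face_edges V f)
                       + u.2 *: row ord_max (face_edges V f).

(* Surface integral through the affine parametrization of the face, whose
   surface element is the square root of the Gram determinant of the edges. *)
Definition integral_face (V : 'M[R]_(4, 3)) (f : 'I_4) (q : poly3 R) : R :=
  Num.sqrt (\det (face_edges V f *m (face_edges V f)^T)) *
  Rintegral (lebesgue_measure \x lebesgue_measure)%E
    reference_triangle (fun u => peval q (face_param V f u)).

(* [bubble V k] is the bubble space of degree k + 1; it is meant for k >= 1. *)
Definition bubble (V : 'M[R]_(4, 3)) (k : nat) : set (poly3 R) :=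
  [set v | Pdeg k.+1 v /\
     forall q f, Pdeg k.-1 q -> integral_face V f (v * q) = 0].

Definition vbubble (V : 'M[R]_(4, 3)) (k : nat) : set ('I_3 -> poly3 R) :=
  [set v | forall i, bubble V k (v i)].

Definition P0perp (V : 'M[R]_(4, 3)) (k : nat) : set (poly3 R) :=
  [set q | Pdeg k q /\ integral_tet V q = 0].

End Tetrahedron.

(* Main.v *)
Require Import Defs.
From HB Require Import structures.
From mathcomp Require Import all_boot all_order all_algebra.
From mathcomp Require Import all_classical all_reals all_analysis.
From mathcomp Require Import measurable_realfun ring lra.
From mathcomp Require mpoly.
Import -(notations) mpoly.

(** Everything is computed in the barycentric coordinates [l_0, ..., l_3] of the
    tetrahedron T, which are polynomials of degree one with sum 1.  Products of
    exactly m of them span the polynomials of degree at most m ([lam_span]), and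
    their integrals are known in closed form: with w = 6 vol(T), the monomial
    l^e integrates to w e! / (|e| + 3)! over T, and to e! / (|e| + 2)! over a
    face on which no coordinate with nonzero exponent vanishes, the integral
    being taken in the parametrization of the face by the reference triangle;
    over the other faces it integrates to 0
    ([integral_tet_monomial], [face_integral_monomial]).

    Divergences of bubbles have mean zero.  Write F_j for the face opposite to
    the vertex V_j.  Comparing the two integral formulas gives the divergence
    theorem in the form ([integral_tet_dderiv])

      int_T (derivative of p along V_j - V_l) = w (int_(F_l) p - int_(F_j) p).

    A bubble has zero integral on each face, so its derivatives along edges, and
    hence its partial derivatives, integrate to zero over T.

    Every polynomial of degree k and mean zero is such a divergence.  It is
    enough that divergences of bubble fields together with the constants span
    all polynomials of degree at most k: if q = div v + c, integration over T
    gives c vol(T) = 0.  Any directional derivative of a bubble b is the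
    divergence of a bubble field, namely b times a constant vector.  Explicit
    bubbles are available: for k = 2,

      l_i (5 l_i^2 - 5 l_i + 1)  and  l_i (3 p_2 - 6 l_i + 5 l_i^2),

    and for k = 3,

      l_i (14 l_i^3 - 21 l_i^2 + 9 l_i - 1),
      l_i (2 p_3 - 9 l_i p_2 + 6 l_i^2)  and  l_0 l_1 l_2 l_3,

    where p_n is the sum of the n-th powers of the coordinates.  Differentiating
    them along edges gives polynomials in the l_i from which, modulo constants,
    all products of k coordinates are obtained by linear combinations
    ([quadratic_generation], [cubic_generation]).

    The integral formulas rest on two facts about Lebesgue measure: an
    invertible affine change of coordinates multiplies volumes by a constant
    ([volume_coordinates_affine]), and Dirichlet's integrals over the reference
    triangle and tetrahedron reduce, one variable at a time, to the Beta
    integral. *)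

Set Implicit Arguments.
Unset Strict Implicit.
Unset Printing Implicit Defensive.

Import Order.TTheory GRing.Theory Num.Theory.
Import numFieldNormedType.Exports.

Local Open Scope classical_set_scope.
Local Open Scope ring_scope.

Local Notation cst3 := (mpolyC 3).
Local Notation var i := (mpolyX _ (mnm1 i)).

(** * Affine maps scale Lebesgue measure *)

(** Stated with preimages, so that it composes and integrates as a pushforward;
    for an invertible affine map the factor [c] is the inverse of the absolute
    value of its determinant. *)
Definition scales_measure (R : realType) d (T : measurableType d)
    (mu : set T -> \bar R) (c : R) (phi : T -> T) : Prop :=
  [/\ measurable_fun setT phi, 0 < c &
    forall A, measurable A -> mu (phi @^-1` A) = (c%:E * mu A)%E].

(** Hides the proof of measurability inside a packed measure whose underlying
    function is known. *)
Lemma image_measure (R : realType) d d' (T : measurableType d) (T' : measurableType d')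
    (mu : {measure set T -> \bar R}) (f : T -> T') : measurable_fun setT f ->
  exists m : {measure set T' -> \bar R}, (m : set T' -> \bar R) = pushforward mu f.
Proof. by move=> mf; unshelve (eexists; reflexivity). Qed.

Section Fibers.
Variables (R : realType) (d1 d2 : measure_display).
Variables (T1 : measurableType d1) (T2 : measurableType d2).
Variable m1 : {sigma_finite_measure set T1 -> \bar R}.
Variable m2 : {sigma_finite_measure set T2 -> \bar R}.

(** A product measure is obtained by integrating the measures of the sections; a
    map acting inside each fiber with the same factor multiplies every section,
    hence the total, by that factor. *)
Lemma scales_fiberr (c : R) (f : T1 -> T2 -> T2) :
  measurable_fun setT (fun p : T1 * T2 => f p.1 p.2) ->
  0 < c -> (forall x, scales_measure m2 c (f x)) ->
  scales_measure (m1 \x m2)%E c (fun p => (p.1, f p.1 p.2)).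
Proof.
move=> mf c0 fc; split=> //; first exact: measurable_fun_pair.
move=> A mA; rewrite /product_measure1 /=.
rewrite -ge0_integralZl//; last by rewrite lee_fin ltW.
  apply: eq_integral => x _ /=; have [_ _ <-] := fc x; last first.
    exact: measurable_xsection.
  by congr (m2 _); apply/seteqP; split => y; rewrite /xsection /= !inE.
exact: measurable_fun_xsection.
Qed.

Lemma scales_fiberl (c : R) (f : T2 -> T1 -> T1) :
  measurable_fun setT (fun p : T1 * T2 => f p.2 p.1) ->
  0 < c -> (forall y, scales_measure m1 c (f y)) ->
  scales_measure (m1 \x m2)%E c (fun p => (f p.2 p.1, p.2)).
Proof.
move=> mf c0 fc.
have mphi : measurable_fun setT (fun p : T1 * T2 => (f p.2 p.1, p.2)).
  exact: measurable_fun_pair.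
have E (B : set (T1 * T2)) : measurable B ->
    (m1 \x m2)%E B = (m1 \x^ m2)%E B.
  by move=> mB; apply: product_measure_unique => //= *; rewrite product_measure2E.
split=> // A mA; rewrite !E//; last first.
  by rewrite -[X in measurable X]setTI; exact: mphi.
rewrite /product_measure2 /= -ge0_integralZl//; last by rewrite lee_fin ltW.
  apply: eq_integral => y _ /=; have [_ _ <-] := fc y; last first.
    exact: measurable_ysection.
  by congr (m1 _); apply/seteqP; split => x; rewrite /ysection /= !inE.
exact: measurable_fun_ysection.
Qed.

End Fibers.

Section ChangeOfVariables.
Variable R : realType.
Local Notation mu := (@lebesgue_measure R).

(** Lebesgue measure is determined by half-open intervals, and the preimage of an
    interval is an interval of length divided by [`|a|]. *)
Lemma scales_affine1 (a b : R) : a != 0 ->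
  scales_measure mu `|a|^-1 (fun x => a * x + b).
Proof.
move=> a0.
have mf : measurable_fun setT ((fun x => a * x + b) : measurableTypeR R -> measurableTypeR R).
  by apply: measurable_funD => //; exact: measurable_funM.
split=> //; first by rewrite invr_gt0 normr_gt0.
move=> A mA.
have [m mE] := image_measure mu mf.
pose k := NngNum (normr_ge0 a).
suff -> : mu A = mscale k m A.
  by rewrite /mscale /= mE /pushforward muleA -EFinM mulVf ?mul1e// normr_eq0.
apply: lebesgue_measure_unique => //= _ [[u v]] _ <-.
rewrite /mscale /= mE /pushforward /=.
have [a_gt0|a_le0] := ltP 0 a.
- rewrite (_ : _ @^-1` _ =
    [set` Interval (BRight ((u - b) / a : R)) (BRight ((v - b) / a))]); last first.
    apply/seteqP; split => x /=; rewrite !in_itv /= => /andP[h1 h2];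
    by rewrite ?ltr_pdivrMr ?ler_pdivlMr// in h1 h2 *; apply/andP; split; lra.
  rewrite !lebesgue_measure_itv /= !lte_fin ltr_pM2r ?invr_gt0// ltrD2r.
  case: ifPn => _; last by rewrite mule0.
  by rewrite -!EFinB -EFinM gtr0_norm//; congr EFin; field.
- have a_lt0 : a < 0 by rewrite lt_neqAle a0.
  rewrite (_ : _ @^-1` _ =
    [set` Interval (BLeft ((v - b) / a : R)) (BLeft ((u - b) / a))]); last first.
    apply/seteqP; split => x /=; rewrite !in_itv /= => /andP[h1 h2];
    by rewrite ?ltr_ndivlMr ?ler_ndivrMr// in h1 h2 *; apply/andP; split; lra.
  rewrite !lebesgue_measure_itv /= !lte_fin ltr_nM2r ?invr_lt0// ltrD2r.
  case: ifPn => _; last by rewrite mule0.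
  by rewrite -!EFinB -EFinM ltr0_norm//; congr EFin; field.
Qed.

Local Notation bR := (measurableTypeR R).
Local Notation mu3 := (mu \x mu \x mu)%E.

Lemma scales_comp d (T : measurableType d) (m : set T -> \bar R) (b c : R)
    (f g : T -> T) :
  scales_measure m b f -> scales_measure m c g -> scales_measure m (b * c) (g \o f).
Proof.
move=> [mf b0 fb] [mg c0 gc]; split; [exact: measurableT_comp|exact: mulr_gt0|].
move=> A mA; rewrite comp_preimage fb ?gc ?EFinM ?muleA//.
by rewrite -[X in measurable X]setTI; exact: mg.
Qed.

(** The three functions are read as new coordinates on space.  The factor is
    existential, so that coordinates can be replaced one by one without keeping
    track of it. *)
Definition volume_coordinates (u v w : R * R * R -> R) : Prop :=
  exists c, scales_measure mu3 c (fun p => (u p, v p, w p)).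

Lemma volume_coordinates_id :
  volume_coordinates (fun p => p.1.1) (fun p => p.1.2) (fun p => p.2).
Proof.
exists 1; have -> : (fun p : R * R * R => (p.1.1, p.1.2, p.2)) = id.
  by apply/funext => -[[]].
by split=> [|//|A mA]; [exact: measurable_id|rewrite mul1e].
Qed.

Lemma volume_coordinates_comp u v w (f : R * R * R -> R * R * R) c :
  volume_coordinates u v w -> scales_measure mu3 c f ->
  volume_coordinates (fun p => (f (u p, v p, w p)).1.1)
    (fun p => (f (u p, v p, w p)).1.2) (fun p => (f (u p, v p, w p)).2).
Proof.
move=> [b hb] hf; exists (b * c).
have /= := scales_comp hb hf; congr (scales_measure _ _ _).
by apply/funext => p /=; case: (f _) => -[].
Qed.

(** The squares with corners (-n, -n) and (n, n) exhaust the plane. *)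
Lemma plane_sigma_finite : exists m : {sigma_finite_measure
  set (bR * bR)%type -> \bar R}, (m : set _ -> _) = (mu \x mu)%E.
Proof.
have sf : sigma_finite setT (mu \x mu)%E.
  exists (fun n => `[- n%:R, n%:R]%classic `*` `[- n%:R, n%:R]%classic).
    apply/esym; rewrite -subTset => -[x y] _.
    exists (maxn (Num.bound `|x|) (Num.bound `|y|)) => //.
    have bnd (z : R) n : (Num.bound `|z| <= n)%N -> `[- n%:R, n%:R]%classic z.
      rewrite -(ler_nat R) /= in_itv /= -ler_norml => /(le_trans _); apply.
      exact/ltW/archi_boundP/normr_ge0.
    by split; apply: bnd; rewrite ?leq_maxl ?leq_maxr.
  move=> n; split; first exact: measurableX.
  rewrite /= product_measure1E//=.
  rewrite lebesgue_measure_itv /=.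
  by case: ifP => _; rewrite ?mule0 ?ltry// -!EFinB -EFinM ltry.
pose mixin := Measure_isSigmaFinite.Build _ _ _ (mu \x mu)%E sf.
pose m : {sigma_finite_measure set (bR * bR)%type -> \bar R} := HB.pack (mu \x mu)%E mixin.
by exists m.
Qed.

Lemma scales_space_fiberl (c : R) (f : bR -> bR * bR -> bR * bR) :
  measurable_fun setT (fun p : bR * bR * bR => f p.2 p.1) -> 0 < c ->
  (forall z, scales_measure (mu \x mu)%E c (f z)) ->
  scales_measure mu3 c (fun p => (f p.2 p.1, p.2)).
Proof.
by have [mu2 <-] := plane_sigma_finite; exact: (@scales_fiberl R _ _ _ _ mu2 mu).
Qed.

Lemma scales_space_fiberr (c : R) (f : bR * bR -> bR -> bR) :
  measurable_fun setT (fun p : bR * bR * bR => f p.1 p.2) -> 0 < c ->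
  (forall q, scales_measure mu c (f q)) ->
  scales_measure mu3 c (fun p => (p.1, f p.1 p.2)).
Proof.
by have [mu2 <-] := plane_sigma_finite; exact: (@scales_fiberr R _ _ _ _ mu2 mu).
Qed.

(** With the two other coordinates fixed, the new coordinate is a one-variable
    affine function of the old one, of slope [a]. *)
Lemma volume_coordinates_replace1 u v w (a b c e : R) : a != 0 -> volume_coordinates u v w ->
  volume_coordinates (fun p => a * u p + b * v p + c * w p + e) v w.
Proof.
move=> a0 huvw; have ia0 : 0 < `|a|^-1 by rewrite invr_gt0 normr_gt0.
have mf : measurable_fun setT
    (fun q : bR * bR * bR => a * q.1.1 + (b * q.1.2 + c * q.2 + e)).
  repeat (apply: measurable_funD => //);
    apply: measurable_funM => //; exact: measurableT_comp.
pose f (z : bR) (q : bR * bR) : bR * bR := (a * q.1 + (b * q.2 + c * z + e), q.2).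
have mF : measurable_fun setT (fun p : bR * bR * bR => f p.2 p.1).
  by apply: measurable_fun_pair => //; exact: measurableT_comp.
have sf z : scales_measure (mu \x mu)%E `|a|^-1 (f z).
  apply: (@scales_fiberl R _ _ _ _ mu mu _
    (fun y x : bR => a * x + (b * y + c * z + e))) => //.
    by repeat (apply: measurable_funD => //);
      exact: measurable_funM.
  by move=> y; exact: scales_affine1.
have := volume_coordinates_comp huvw (scales_space_fiberl mF ia0 sf).
by congr (volume_coordinates _ _ _); apply/funext => p /=; rewrite !addrA.
Qed.

Lemma volume_coordinates_replace2 u v w (a b c e : R) : b != 0 -> volume_coordinates u v w ->
  volume_coordinates u (fun p => a * u p + b * v p + c * w p + e) w.
Proof.
move=> b0 huvw; have ib0 : 0 < `|b|^-1 by rewrite invr_gt0 normr_gt0.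
have mf : measurable_fun setT
    (fun q : bR * bR * bR => b * q.1.2 + (a * q.1.1 + c * q.2 + e)).
  repeat (apply: measurable_funD => //);
    apply: measurable_funM => //; exact: measurableT_comp.
pose f (z : bR) (q : bR * bR) : bR * bR := (q.1, b * q.2 + (a * q.1 + c * z + e)).
have mF : measurable_fun setT (fun p : bR * bR * bR => f p.2 p.1).
  by apply: measurable_fun_pair => //; exact: measurableT_comp.
have sf z : scales_measure (mu \x mu)%E `|b|^-1 (f z).
  apply: (@scales_fiberr R _ _ _ _ mu mu _
    (fun x y : bR => b * y + (a * x + c * z + e))) => //.
    by repeat (apply: measurable_funD => //);
      exact: measurable_funM.
  by move=> x; exact: scales_affine1.
have := volume_coordinates_comp huvw (scales_space_fiberl mF ib0 sf).
by congr (volume_coordinates _ _ _); apply/funext => p /=; ring.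
Qed.

Lemma volume_coordinates_replace3 u v w (a b c e : R) : c != 0 -> volume_coordinates u v w ->
  volume_coordinates u v (fun p => a * u p + b * v p + c * w p + e).
Proof.
move=> c0 huvw; have ic0 : 0 < `|c|^-1 by rewrite invr_gt0 normr_gt0.
pose f (q : bR * bR) (z : bR) : bR := c * z + (a * q.1 + b * q.2 + e).
have mF : measurable_fun setT (fun p : bR * bR * bR => f p.1 p.2).
  repeat (apply: measurable_funD => //);
    apply: measurable_funM => //; exact: measurableT_comp.
have sf q : scales_measure mu `|c|^-1 (f q) by exact: scales_affine1.
have := volume_coordinates_comp huvw (scales_space_fiberr mF ic0 sf).
by congr (volume_coordinates _ _ _); apply/funext => p; rewrite /f /=; ring.
Qed.

(** Up to sign, a swap is a product of three shears, as in the exchange of two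
    variables by additions and subtractions. *)
Lemma volume_coordinates_swap12 u v w : volume_coordinates u v w -> volume_coordinates v u w.
Proof.
move=> h.
have h1 := volume_coordinates_replace1 1 0 0 (oner_neq0 R) h.
have N1 : -1 != 0 :> R by rewrite oppr_eq0 oner_eq0.
have h2 := volume_coordinates_replace2 1 0 0 N1 h1.
have := volume_coordinates_replace1 (-1) 0 0 (oner_neq0 R) h2.
by congr (volume_coordinates _ _ _); apply/funext => p /=; ring.
Qed.

Lemma volume_coordinates_swap23 u v w : volume_coordinates u v w -> volume_coordinates u w v.
Proof.
move=> h.
have h1 := volume_coordinates_replace2 0 1 0 (oner_neq0 R) h.
have N1 : -1 != 0 :> R by rewrite oppr_eq0 oner_eq0.
have h2 := volume_coordinates_replace3 0 1 0 N1 h1.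
have := volume_coordinates_replace2 0 (-1) 0 (oner_neq0 R) h2.
by congr (volume_coordinates _ _ _); apply/funext => p /=; ring.
Qed.

Definition affine_form (a : R * R * R) (e : R) (p : R * R * R) : R :=
  a.1.1 * p.1.1 + a.1.2 * p.1.2 + a.2 * p.2 + e.

(** The minor on the first two columns. *)
Definition minor2 (a b : R * R * R) : R := a.1.1 * b.1.2 - a.1.2 * b.1.1.

(** Cofactor expansion along the third column. *)
Definition det3 (a b c : R * R * R) : R :=
  a.2 * minor2 b c - b.2 * minor2 a c + c.2 * minor2 a b.

(** Gaussian elimination without row exchange: starting from x, y, z, the
    coordinates become the three forms one after the other, and the coefficients
    of the coordinate being replaced are the pivots [a.1.1], [minor2 a b / a.1.1]
    and [det3 a b c / minor2 a b]. *)
Lemma volume_coordinates_pivots a b c ea eb ec :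
  a.1.1 != 0 -> minor2 a b != 0 -> det3 a b c != 0 ->
  volume_coordinates (affine_form a ea) (affine_form b eb) (affine_form c ec).
Proof.
case: a b c => [[a0 a1] a2] [[b0 b1] b2] [[c0 c1] c2] /= p1 p2 p3.
have h1 := volume_coordinates_replace1 a1 a2 ea p1 volume_coordinates_id.
have q2 : minor2 (a0, a1, a2) (b0, b1, b2) / a0 != 0.
  by rewrite mulf_neq0// invr_eq0.
have h2 := volume_coordinates_replace2 (b0 / a0) (b2 - b0 / a0 * a2)
  (eb - b0 / a0 * ea) q2 h1.
pose m := minor2 (a0, a1, a2) (b0, b1, b2).
have q3 : det3 (a0, a1, a2) (b0, b1, b2) (c0, c1, c2) / m != 0.
  by rewrite mulf_neq0// invr_eq0.
(* Cramer's rule: s a + t b agrees with c in the first two entries. *)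
pose s := (c0 * b1 - c1 * b0) / m; pose t := (a0 * c1 - a1 * c0) / m.
have := volume_coordinates_replace3 s t (ec - s * ea - t * eb) q3 h2.
rewrite /m /minor2 /= in p2 *.
congr (volume_coordinates _ _ _); apply/funext => -[[x y] z];
  rewrite /affine_form /s /t /m /det3 /minor2 /=; field; rewrite ?p1 ?p2//.
Qed.

(** If the determinant is nonzero, one of the three minors on the first two
    columns is, and so is one entry in its first column; permuting the forms
    brings these to the pivot positions. *)
Lemma volume_coordinates_affine a b c ea eb ec : det3 a b c != 0 ->
  volume_coordinates (affine_form a ea) (affine_form b eb) (affine_form c ec).
Proof.
have minor0 u v : minor2 u v != 0 -> u.1.1 != 0 \/ v.1.1 != 0.
  have [u0|] := eqVneq u.1.1 0; last by left.
  have [v0|] := eqVneq v.1.1 0; last by right.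
  by rewrite /minor2 u0 v0 mul0r mulr0 subrr eqxx.
have minorC u v : minor2 v u = - minor2 u v by rewrite /minor2; ring.
have pivots u v w eu ev ew : minor2 u v != 0 -> det3 u v w != 0 ->
    volume_coordinates (affine_form u eu) (affine_form v ev) (affine_form w ew).
  move=> m0 d0; case/minor0: (m0) => h; first exact: volume_coordinates_pivots.
  apply: volume_coordinates_swap12; apply: volume_coordinates_pivots => //.
    by rewrite minorC oppr_eq0.
  by move: d0; rewrite -oppr_eq0 /det3 /minor2; congr (_ != 0); ring.
move=> d0.
have [mab|mab] := eqVneq (minor2 a b) 0; last exact: pivots.
have [mac|mac] := eqVneq (minor2 a c) 0; last first.
  apply: volume_coordinates_swap23; apply: pivots => //.
  by move: d0; rewrite -oppr_eq0 /det3 /minor2; congr (_ != 0); ring.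
have [mbc|mbc] := eqVneq (minor2 b c) 0.
  by move: d0; rewrite /det3 mab mac mbc !mulr0 subrr addr0 eqxx.
apply: volume_coordinates_swap12; apply: volume_coordinates_swap23; apply: pivots => //.
by move: d0; rewrite /det3 /minor2; congr (_ != 0); ring.
Qed.

End ChangeOfVariables.

(** * Integrals under a scaling map and over a region under a graph *)
Lemma scales_integral (R : realType) d (T : measurableType d)
    (mu : {measure set T -> \bar R}) c (phi : T -> T) (D : set T) (f : T -> R) :
  scales_measure mu c phi -> measurable D -> measurable_fun D f ->
  (forall x, D x -> 0 <= f x) ->
  (\int[mu]_(x in phi @^-1` D) (f (phi x))%:E =
   c%:E * \int[mu]_(x in D) (f x)%:E)%E.
Proof.
move=> [mphi c0 phic] mD mf f0.
have /measurable_EFinP mEf := mf.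
have f0' : {in D, forall y, (0 <= (f y)%:E)%E}.
  by move=> y /[!inE] Dy; rewrite lee_fin f0.
have := ge0_integral_pushforward mphi mu mD mEf f0'.
rewrite /comp => <-.
pose k := NngNum (ltW c0).
rewrite -(ge0_integral_mscale _ mD k) //.
by apply: eq_measure_integral => A mA _; rewrite /mscale /= /pushforward phic.
Qed.

Lemma integral_subgraph (R : realType) d (T : measurableType d)
    (m : {sigma_finite_measure set T -> \bar R})
    (B : set T) (h : T -> R) (D : set (T * measurableTypeR R)) (f : T * measurableTypeR R -> R) :
  (forall w y, D (w, y) <-> B w /\ 0 <= y <= h w) ->
  measurable D -> measurable_fun setT f -> (forall p, D p -> 0 <= f p) ->
  (\int[(m \x (@lebesgue_measure R))%E]_(p in D) (f p)%:E =
   \int[m]_(w in B) \int[@lebesgue_measure R]_(y in `[0%R, h w]) (f (w, y))%:E)%E.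
Proof.
move=> DE mD mf f0.
have /measurable_EFinP mEf := mf.
have mfD : measurable_fun setT ((EFin \o f) \_ D).
  by apply/(measurable_restrictT _ mD); exact: measurable_funTS mEf.
rewrite integral_mkcond fubini_tonelli1//; last first.
- by move=> p; apply: erestrict_ge0 => q Dq; rewrite lee_fin f0.
rewrite [RHS]integral_mkcond; apply: eq_integral => w _.
rewrite /fubini_F /patch; have [Bw|nBw] := pselect (B w); [rewrite mem_set//|rewrite memNset//].
  rewrite [RHS]integral_mkcond; apply: eq_integral => y _; rewrite /patch.
  suff -> : ((w, y) \in D) = (y \in `[0, h w]%classic) by [].
  by apply/idP/idP; rewrite !inE DE /= in_itv /=; [case|].
apply: integral0_eq => y _; case: ifPn => // /[!inE] /DE[Bw _].
by case: nBw.
Qed.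

(** * Dirichlet integrals on the reference triangle and tetrahedron *)
Section Dirichlet.
Variable R : realType.
Local Notation mu := (@lebesgue_measure R).
Local Notation bR := (measurableTypeR R).
Local Notation mu3 := (mu \x mu \x mu)%E.

Lemma beta_unit_interval (a b : nat) :
  (\int[mu]_(t in `[0%R, 1%R]) (t ^+ b * (1 - t) ^+ a)%:E =
   (a`!%:R * b`!%:R / (a + b).+1`!%:R)%:E)%E.
Proof.
have := @beta_fun_fact R b a; rewrite addnC natrM [b`!%:R * _]mulrC => <-.
rewrite EFin_beta_fun [LHS]integral_mkcond; apply: eq_integral => t _.
by rewrite /= restrict_EFin.
Qed.

(** The substitution t = L s; the degenerate interval L = 0 has measure zero. *)
Lemma beta_interval (L : R) (a b : nat) : 0 <= L ->
  (\int[mu]_(t in `[0%R, L]) (t ^+ b * (L - t) ^+ a)%:E =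
   (a`!%:R * b`!%:R / (a + b).+1`!%:R * L ^+ (a + b).+1)%:E)%E.
Proof.
rewrite le_eqVlt => /predU1P[<-|L0].
  by rewrite set_itv1 integral_set1 exprS !(mul0r, mulr0).
have Li0 : L^-1 != 0 by rewrite invr_eq0 gt_eqF.
pose f (t : R) : R := L ^+ (a + b) * (t ^+ b * (1 - t) ^+ a).
have mf (A : set bR) : measurable_fun A (f : bR -> bR).
  by do ! apply: measurable_funM => //; apply: measurable_funX => //;
    apply: measurable_funB.
have f0 (t : R) : `[0, 1]%classic t -> 0 <= f t.
  rewrite /= in_itv /= => /andP[t0 t1].
  by rewrite !mulr_ge0 ?exprn_ge0 ?subr_ge0// ltW.
have := scales_integral (scales_affine1 0 Li0)
  (@measurable_itv R `[0, 1]) (mf _) f0.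
have -> : (fun t => L^-1 * t + 0) @^-1` `[0, 1] = `[0, L]%classic.
  apply/seteqP; split => t; rewrite /= !in_itv /= addr0 mulrC;
  by rewrite ler_pdivlMr// ler_pdivrMr// mul0r mul1r.
rewrite (eq_integral (fun t : bR => (t ^+ b * (L - t) ^+ a)%:E)) => [->|t _].
  rewrite normfV gtr0_norm// invrK /f.
  under eq_integral do rewrite EFinM.
  rewrite ge0_integralZl_EFin// ?beta_unit_interval ?exprn_ge0 1?ltW//.
  - by rewrite -!EFinM; congr EFin; rewrite exprS; ring.
  - by move=> t /f0; rewrite /f lee_fin pmulr_rge0// exprn_gt0.
  - apply/measurable_EFinP; do ! apply: measurable_funM => //;
      apply: measurable_funX => //; exact: measurable_funB.
rewrite addr0 /f.
have -> : t ^+ b * (L - t) ^+ a = (L * (L^-1 * t)) ^+ b * (L * (1 - L^-1 * t)) ^+ a.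
  by congr (_ ^+ _ * _ ^+ _); field; rewrite gt_eqF.
by rewrite !exprMn exprD; congr EFin; ring.
Qed.

Lemma measurable_ge0_set d (T : measurableType d) (f : T -> R) :
  measurable_fun setT f -> measurable [set x | 0 <= f x].
Proof.
move=> mf; rewrite (_ : [set _ | _] = setT `&` f @^-1` `[0, +oo[%classic).
  exact: mf.
by rewrite setTI; apply/seteqP; split => x; rewrite /= in_itv /= andbT.
Qed.

Local Notation triangle := (@reference_triangle R : set (bR * bR)).

Lemma measurable_triangle : measurable triangle.
Proof.
rewrite (_ : triangle = [set u : bR * bR | 0 <= u.1 :> R] `&`
  [set u | 0 <= u.2 :> R] `&` [set u | 0 <= 1 - u.1 - u.2 :> R]).
  apply: measurableI; [apply: measurableI|]; apply: measurable_ge0_set => //.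
  by do ! apply: measurable_funB => //.
apply/seteqP; split => u /=; last by move=> [[? ?] ?]; split=> //; lra.
by move=> [? ? ?]; split=> //; lra.
Qed.

Lemma measurable_dirichlet2 a b c :
  measurable_fun setT (fun u : bR * bR => (1 - u.1 - u.2) ^+ a * u.1 ^+ b * u.2 ^+ c : R).
Proof.
by do ! apply: measurable_funM => //; apply: measurable_funX => //;
  do ! apply: measurable_funB => //.
Qed.

(** The inner integral over [[0, 1 - x]] is a Beta integral, which contributes a
    power of 1 - x; what remains is a Beta integral over the unit interval. *)
Lemma dirichlet_triangle a b c :
  (\int[(mu \x mu)%E]_(u in triangle)
      ((1 - u.1 - u.2) ^+ a * u.1 ^+ b * u.2 ^+ c : R)%:E =
   (a`!%:R * b`!%:R * c`!%:R / (a + b + c).+2`!%:R : R)%:E)%E.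
Proof.
rewrite (@integral_subgraph R _ _ mu `[0, 1]%classic (fun x => 1 - x) _
  (fun u : bR * bR => (1 - u.1 - u.2) ^+ a * u.1 ^+ b * u.2 ^+ c : R)) /=; last 4 first.
- move=> x y; rewrite /= in_itv /=; split=> [[/= ? ? ?]|[/andP[? ?] /andP[? ?]]].
    by split; apply/andP; split=> //; lra.
  by split=> //=; lra.
- exact: measurable_triangle.
- exact: measurable_dirichlet2.
- by move=> u [? ? ?]; rewrite !mulr_ge0 ?exprn_ge0//; lra.
transitivity (\int[mu]_(x in `[0%R, 1%R]) (a`!%:R * c`!%:R / (a + c).+1`!%:R *
    (x ^+ b * (1 - x) ^+ (a + c).+1))%:E)%E.
  apply: eq_integral => x; rewrite inE /= in_itv /= => /andP[x0 x1].
  rewrite (eq_integral (fun y : bR =>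
      (x ^+ b)%:E * (y ^+ c * (1 - x - y) ^+ a : R)%:E)%E); last first.
    by move=> y _; rewrite -EFinM; congr EFin; ring.
  rewrite ge0_integralZl_EFin ?exprn_ge0//.
  - by rewrite beta_interval ?subr_ge0// -EFinM; congr EFin; ring.
  - move=> y /=; rewrite in_itv /= => /andP[y0 y1].
    by rewrite lee_fin mulr_ge0 ?exprn_ge0// subr_ge0.
  - apply/measurable_EFinP; apply: measurable_funM; apply: measurable_funX => //.
    exact: measurable_funB.
under eq_integral do rewrite EFinM.
rewrite ge0_integralZl_EFin//.
- rewrite beta_unit_interval -EFinM; congr EFin; rewrite !addSn addnAC.
  by field; rewrite !pnatr_eq0 -!lt0n !fact_gt0.
- move=> y /=; rewrite in_itv /= => /andP[y0 y1].
  by rewrite lee_fin mulr_ge0 ?exprn_ge0// subr_ge0.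
- apply/measurable_EFinP; apply: measurable_funM; apply: measurable_funX => //.
  exact: measurable_funB.
Qed.

Definition reference_tet : set (bR * bR * bR) :=
  [set p | [/\ 0 <= p.1.1 :> R, 0 <= p.1.2 :> R, 0 <= p.2 :> R
             & 0 <= 1 - p.1.1 - p.1.2 - p.2 :> R]].

Lemma measurable_reference_tet : measurable reference_tet.
Proof.
rewrite (_ : reference_tet = [set p : bR * bR * bR | 0 <= p.1.1 :> R] `&`
  [set p | 0 <= p.1.2 :> R] `&` [set p | 0 <= p.2 :> R] `&`
  [set p | 0 <= 1 - p.1.1 - p.1.2 - p.2 :> R]).
  apply: measurableI; [apply: measurableI; [apply: measurableI|]|];
    apply: measurable_ge0_set => //; do ? apply: measurable_funB => //;
    exact: measurableT_comp.
by apply/seteqP; split => p /=; [move=> []|move=> [[[]]]].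
Qed.

Lemma measurable_dirichlet3 a b c e :
  measurable_fun setT (fun p : bR * bR * bR =>
    (1 - p.1.1 - p.1.2 - p.2) ^+ a * p.1.1 ^+ b * p.1.2 ^+ c * p.2 ^+ e : R).
Proof.
by do ! apply: measurable_funM => //; apply: measurable_funX => //;
  do ? apply: measurable_funB => //; exact: measurableT_comp.
Qed.

(** Integrating out the last variable leaves a Dirichlet integral over the
    triangle, with a higher exponent on its first barycentric coordinate. *)
Lemma dirichlet_tet a b c e :
  (\int[mu3]_(p in reference_tet) ((1 - p.1.1 - p.1.2 - p.2) ^+ a *
      p.1.1 ^+ b * p.1.2 ^+ c * p.2 ^+ e : R)%:E =
   (a`!%:R * b`!%:R * c`!%:R * e`!%:R / (a + b + c + e).+3`!%:R : R)%:E)%E.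
Proof.
have [mu2 mu2E] := @plane_sigma_finite R; rewrite -mu2E.
rewrite (@integral_subgraph R _ _ mu2 triangle (fun u => 1 - u.1 - u.2) _
  (fun p : bR * bR * bR => (1 - p.1.1 - p.1.2 - p.2) ^+ a *
      p.1.1 ^+ b * p.1.2 ^+ c * p.2 ^+ e : R)) /=; last 4 first.
- move=> u z; split=> [[/= ? ? ? ?]|[[? ? ?] /andP[? ?]]].
    by split; [split=> //; lra|apply/andP; split=> //; lra].
  by split=> //=; lra.
- exact: measurable_reference_tet.
- exact: measurable_dirichlet3.
- by move=> p [? ? ? ?]; rewrite !mulr_ge0 ?exprn_ge0//; lra.
transitivity (\int[mu2]_(u in triangle) (a`!%:R * e`!%:R / (a + e).+1`!%:R *
    ((1 - u.1 - u.2) ^+ (a + e).+1 * u.1 ^+ b * u.2 ^+ c))%:E)%E.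
  apply: eq_integral => u; rewrite inE => -[u1 u2 u12].
  rewrite (eq_integral (fun z : bR =>
      (u.1 ^+ b * u.2 ^+ c)%:E * (z ^+ e * (1 - u.1 - u.2 - z) ^+ a : R)%:E)%E); last first.
    by move=> z _; rewrite -EFinM; congr EFin; ring.
  rewrite ge0_integralZl_EFin ?mulr_ge0 ?exprn_ge0//.
  - rewrite beta_interval -?EFinM; last by lra.
    by congr EFin; ring.
  - move=> z /=; rewrite in_itv /= => /andP[z0 z1].
    by rewrite lee_fin mulr_ge0 ?exprn_ge0// subr_ge0.
  - apply/measurable_EFinP; apply: measurable_funM; apply: measurable_funX => //.
    exact: measurable_funB.
under eq_integral do rewrite EFinM.
rewrite ge0_integralZl_EFin//.
- have := dirichlet_triangle (a + e).+1 b c; rewrite -mu2E => ->.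
  rewrite -EFinM; congr EFin; rewrite !addSn.
  rewrite (_ : a + e + b + c = a + b + c + e)%N; last by ring.
  by field; rewrite !pnatr_eq0 -!lt0n !fact_gt0.
- exact: measurable_triangle.
- by move=> u [? ? ?]; rewrite lee_fin !mulr_ge0 ?exprn_ge0//; lra.
- apply/measurable_EFinP; apply: measurable_funTS; exact: measurable_dirichlet2.
Qed.

End Dirichlet.

(** * Polynomials in barycentric coordinates *)
Section Barycentric.
Variable R : realType.
Local Notation P := (poly3 R).

Lemma Pdeg_coef m (p : P) :
  Pdeg m p <-> forall w, (m < mdeg w)%N -> mcoeff w p = 0.
Proof.
rewrite /Pdeg /=; split=> [pm w mw|h].
  by apply: memN_msupp_eq0; apply: msize_mdeg_ge; exact: leq_trans pm _.
rewrite msizeE; apply/bigmax_leqP_seq => w wp _; rewrite ltnS leqNgt.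
by apply/negP => /h/eqP; rewrite mcoeff_eq0 wp.
Qed.

Lemma Pdeg_linear m a (p q : P) : Pdeg m p -> Pdeg m q -> Pdeg m (a *: p + q).
Proof.
move=> /Pdeg_coef hp /Pdeg_coef hq; apply/Pdeg_coef => w mw.
by rewrite mcoeffD mcoeffZ hp// hq// mulr0 addr0.
Qed.

Lemma Pdeg_mul a b (p q : P) : Pdeg a p -> Pdeg b q -> Pdeg (a + b) (p * q).
Proof.
rewrite /Pdeg /= => pa qb.
have [->|p0] := eqVneq p 0; first by rewrite mul0r msize0.
have [->|q0] := eqVneq q 0; first by rewrite mulr0 msize0.
rewrite msizeM// -subn1 leq_subLR; apply: leq_trans (leq_add pa qb) _.
by rewrite add1n addSn addnS.
Qed.

Lemma Pdeg_mderiv m i (p : P) : Pdeg m.+1 p -> Pdeg m (mderiv i p).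
Proof.
move=> /Pdeg_coef hp; apply/Pdeg_coef => w mw.
by rewrite mcoeff_mderiv hp ?mul0rn// mdegD mdeg1 addn1 ltnS.
Qed.

Lemma Pdeg_le a b (p : P) : (a <= b)%N -> Pdeg a p -> Pdeg b p.
Proof. by move=> ab /leq_trans; apply; rewrite ltnS. Qed.

Lemma PdegC m c : Pdeg m (cst3 c : P).
Proof. by rewrite /Pdeg /= msizeC; case: eqP. Qed.

Lemma PdegD m (p q : P) : Pdeg m p -> Pdeg m q -> Pdeg m (p + q).
Proof. by rewrite -[p in p + q]scale1r; exact: Pdeg_linear. Qed.

Lemma PdegN m (p : P) : Pdeg m p -> Pdeg m (- p).
Proof. by rewrite /Pdeg /= msizeN. Qed.

Lemma Pdeg_nat m n : Pdeg m (n%:R : P).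
Proof. by rewrite -mpolyC_nat; exact: PdegC. Qed.

Lemma Pdeg_natM m n (p : P) : Pdeg m p -> Pdeg m (n%:R * p).
Proof. by rewrite -[m in X in _ -> X]add0n; apply: Pdeg_mul; exact: Pdeg_nat. Qed.

(** Directional derivative, with constant direction [t]. *)
Definition dderiv (t : 'I_3 -> R) (p : P) : P := \sum_d t d *: mderiv d p.

Lemma dderiv_linear t a p q : dderiv t (a *: p + q) = a *: dderiv t p + dderiv t q.
Proof.
rewrite scaler_sumr -big_split /=; apply: eq_bigr => d _.
by rewrite mderivD mderivZ scalerDr !scalerA mulrC.
Qed.

Lemma dderivM t p q : dderiv t (p * q) = dderiv t p * q + p * dderiv t q.
Proof.
rewrite mulr_suml mulr_sumr -big_split /=; apply: eq_bigr => d _.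
by rewrite mderivM scalerDr scalerAl scalerAr.
Qed.

Lemma dderivD t (p q : P) : dderiv t (p + q) = dderiv t p + dderiv t q.
Proof. by rewrite -[p in LHS]scale1r dderiv_linear scale1r. Qed.

Lemma dderiv0 t : dderiv t (0 : P) = 0.
Proof. by rewrite /dderiv big1 // => d _; rewrite raddf0 scaler0. Qed.

Lemma dderivN t (p : P) : dderiv t (- p) = - dderiv t p.
Proof. by rewrite -[- p]addr0 -scaleN1r dderiv_linear dderiv0 scaleN1r addr0. Qed.

Lemma dderiv_natM t n (p : P) : dderiv t (n%:R * p) = n%:R * dderiv t p.
Proof.
by rewrite mulr_natl -scaler_nat -[_ *: p]addr0 dderiv_linear dderiv0 addr0 scaler_nat mulr_natl.
Qed.

Lemma dderiv1 t : dderiv t 1 = 0 :> P.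
Proof. by rewrite /dderiv big1 // => d _; rewrite -mpolyC1 mderivC scaler0. Qed.

Lemma dderivX t (p : P) n : dderiv t (p ^+ n) = n%:R * p ^+ n.-1 * dderiv t p.
Proof.
elim: n => [|n IH]; first by rewrite dderiv1 !mul0r.
rewrite exprS dderivM IH /= mulrS; case: n {IH} => [|n] /=; first by rewrite !expr0; ring.
by rewrite exprS; ring.
Qed.

Section Coordinates.
Variable V : 'M[R]_(4, 3).
Hypothesis hV : nondegenerate_tet V.

(** The rows are the vectors (1, V_i): the affine map of value 1 at V_i and 0 at
    the other vertices has the i-th column of the inverse as coefficients. *)
Definition homogeneous_vertices : 'M[R]_4 :=
  \matrix_(i, j) (if unlift ord0 j is Some d then V i d else 1).
Local Notation W := homogeneous_vertices.
Local Notation N := (invmx W).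

(** A relation between the rows is an affine relation between the vertices; its
    coefficients off vertex 0 are a linear relation between the edges from
    vertex 0, which are independent. *)
Lemma homogeneous_vertices_unit : W \in unitmx.
Proof.
rewrite -row_free_unit; apply: inj_row_free => v vW0.
have sumv : v ord0 ord0 + \sum_i v ord0 (lift ord0 i) = 0.
  move/matrixP: vW0 => /(_ ord0 ord0); rewrite [RHS]mxE; apply: etrans.
  rewrite [RHS]mxE [RHS]big_ord_recl !mxE unlift_none mulr1; congr (_ + _); apply: eq_bigr => i _.
  by rewrite mxE unlift_none mulr1.
have sumvV d : v ord0 ord0 * V ord0 d + \sum_i v ord0 (lift ord0 i) * V (lift ord0 i) d = 0.
  move/matrixP: vW0 => /(_ ord0 (lift ord0 d)); rewrite [RHS]mxE; apply: etrans.
  rewrite [RHS]mxE [RHS]big_ord_recl !mxE liftK; congr (_ + _); apply: eq_bigr => i _.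
  by rewrite mxE liftK.
have u0 : (\row_i v ord0 (lift ord0 i)) = 0 :> 'rV_3.
  apply/eqP; rewrite -(mulmx_free_eq0 _ hV); apply/eqP/matrixP => z d.
  rewrite !mxE; under eq_bigr do rewrite !mxE mulrBr.
  rewrite sumrB -mulr_suml; apply: etrans (sumvV d).
  have -> : \sum_i v ord0 (lift ord0 i) = - v ord0 ord0.
    by apply/eqP; rewrite -addr_eq0 addrC sumv.
  by rewrite mulNr opprK addrC.
have v0 i : v ord0 (lift ord0 i) = 0.
  by move/matrixP: u0 => /(_ ord0 i); rewrite !mxE.
apply/matrixP => z j; rewrite (ord1 z) mxE.
case: (unliftP ord0 j) => [i ->|->]; first exact: v0.
by move: sumv; rewrite big1 ?addr0// => i _.
Qed.

(** This lemma and the four after it are the block entries of W N = 1 and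
    N W = 1, where W is the matrix of homogeneous vertices and N its inverse. *)
Lemma vertex_kronecker i j : (N ord0 j + \sum_d V i d * N (lift ord0 d) j) = (i == j)%:R.
Proof.
have /matrixP/(_ i j) := mulmxV homogeneous_vertices_unit.
rewrite [RHS]mxE => <-; rewrite [RHS]mxE [RHS]big_ord_recl !mxE unlift_none mul1r; congr (_ + _).
by apply: eq_bigr => d _; rewrite mxE liftK.
Qed.

Lemma gradient_vertices d c : \sum_j V j c * N (lift ord0 d) j = (d == c)%:R.
Proof.
have /matrixP/(_ (lift ord0 d) (lift ord0 c)) := mulVmx homogeneous_vertices_unit.
rewrite [RHS]mxE (inj_eq lift_inj) => <-; rewrite [RHS]mxE.
by apply: eq_bigr => j _; rewrite mxE liftK mulrC.
Qed.

Lemma gradient_sum d : \sum_j N (lift ord0 d) j = 0.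
Proof.
have /matrixP/(_ (lift ord0 d) ord0) := mulVmx homogeneous_vertices_unit.
rewrite [RHS]mxE; apply: etrans; rewrite [RHS]mxE.
by apply: eq_bigr => j _; rewrite mxE unlift_none mulr1.
Qed.

Lemma constant_coef_sum : \sum_j N ord0 j = 1.
Proof.
have /matrixP/(_ ord0 ord0) := mulVmx homogeneous_vertices_unit.
rewrite [RHS]mxE; apply: etrans; rewrite [RHS]mxE.
by apply: eq_bigr => j _; rewrite mxE unlift_none mulr1.
Qed.

Lemma constant_coef_vertices c : \sum_j V j c * N ord0 j = 0.
Proof.
have /matrixP/(_ ord0 (lift ord0 c)) := mulVmx homogeneous_vertices_unit.
rewrite [RHS]mxE; apply: etrans; rewrite [RHS]mxE.
by apply: eq_bigr => j _; rewrite mxE liftK mulrC.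
Qed.

Definition lam (i : 'I_4) : P :=
  N ord0 i *: 1 + \sum_d N (lift ord0 d) i *: var d.

Lemma sum_lam : \sum_i lam i = 1.
Proof.
rewrite big_split /= -scaler_suml constant_coef_sum scale1r exchange_big /= big1 ?addr0// => d _.
by rewrite -scaler_suml gradient_sum scale0r.
Qed.

Lemma var_lam c : var c = \sum_i V i c *: lam i.
Proof.
under eq_bigr do rewrite scalerDr scalerA scaler_sumr.
rewrite big_split /= -scaler_suml constant_coef_vertices scale0r add0r.
rewrite exchange_big /= (bigD1 c)//= [X in _ + X]big1 => [|d dc].
  rewrite addr0; under eq_bigr do rewrite scalerA.
  by rewrite -scaler_suml gradient_vertices eqxx scale1r.
under eq_bigr do rewrite scalerA.
by rewrite -scaler_suml gradient_vertices (negbTE dc) scale0r.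
Qed.

Lemma Pdeg_sum (I : Type) (r : seq I) (Q : pred I) (F : I -> P) m :
  (forall i, Pdeg m (F i)) -> Pdeg m (\sum_(i <- r | Q i) F i).
Proof.
move=> h; elim/big_ind: _ => [|p q hp hq|//]; first by rewrite -mpolyC0; exact: PdegC.
by rewrite -[p]scale1r; exact: Pdeg_linear.
Qed.

Lemma Pdeg_lam i : Pdeg 1 (lam i).
Proof.
apply: Pdeg_linear; first by rewrite -mpolyC1; exact: PdegC.
apply: Pdeg_sum => d; rewrite -[_ *: _]addr0; apply: Pdeg_linear.
  by rewrite /Pdeg /= msizeX mdeg1.
by rewrite -mpolyC0; exact: PdegC.
Qed.

Lemma peval_lam i x :
  peval (lam i) x = N ord0 i + \sum_d N (lift ord0 d) i * x ord0 d.
Proof.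
rewrite /peval mevalD mevalZ meval1 mulr1 raddf_sum /=; congr (_ + _).
by apply: eq_bigr => d _; rewrite mevalZ mevalXU.
Qed.

Lemma peval_lam_comb i (l : 'I_4 -> R) : \sum_j l j = 1 ->
  peval (lam i) (\sum_j l j *: row j V) = l i.
Proof.
move=> l1; rewrite peval_lam.
transitivity (\sum_j l j * (j == i)%:R); last first.
  by rewrite (bigD1 i)//= eqxx mulr1 big1 ?addr0// => j /negbTE ->; rewrite mulr0.
under [RHS]eq_bigr do rewrite -vertex_kronecker mulrDr.
rewrite big_split /= -mulr_suml l1 mul1r; congr (_ + _).
under [RHS]eq_bigr do rewrite mulr_sumr.
rewrite exchange_big /=; apply: eq_bigr => d _.
rewrite summxE mulr_sumr; apply: eq_bigr => j _; rewrite !mxE; ring.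
Qed.

Lemma lam_vertices x : x = \sum_i peval (lam i) x *: row i V.
Proof.
apply/rowP => c; rewrite summxE.
have := congr1 (fun p => peval p x) (var_lam c); rewrite /peval mevalXU => ->.
rewrite raddf_sum /=; apply: eq_bigr => i _.
by rewrite mevalZ !mxE mulrC.
Qed.

Lemma sum_peval_lam x : \sum_i peval (lam i) x = 1.
Proof.
have := congr1 (fun p => peval p x) sum_lam; rewrite /peval meval1 => <-.
by rewrite raddf_sum.
Qed.

Lemma mnm_subxx (w : multinom 3) : mnm_sub w w = mnm0.
Proof. by apply/mnmP => i; rewrite mnmBE subnn mnm0E. Qed.

Lemma mderiv_lam d i : mderiv d (lam i) = cst3 (N (lift ord0 d) i).
Proof.
rewrite /lam mderivD mderivZ -mpolyC1 mderivC scaler0 add0r raddf_sum /=.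
rewrite (bigD1 d)//= big1 ?addr0 => [|c cd].
  by rewrite mderivZ mderivX mnm1E eqxx scale1r mnm_subxx mpolyX0 alg_mpolyC.
by rewrite mderivZ mderivX mnm1E (negbTE cd) scale0r scaler0.
Qed.

Definition edge (j l : 'I_4) : 'I_3 -> R := fun d => V j d - V l d.

Lemma dderiv_lam j l i :
  dderiv (edge j l) (lam i) = (j == i)%:R - (l == i)%:R.
Proof.
rewrite /dderiv; under eq_bigr do rewrite mderiv_lam -alg_mpolyC scalerA.
rewrite -scaler_suml; under eq_bigr do rewrite mulrBl.
have <- : ((j == i)%:R - (l == i)%:R) *: 1 = (j == i)%:R - (l == i)%:R :> P.
  by rewrite scalerBl !scaler_nat.
by rewrite sumrB -!vertex_kronecker; congr (_ *: _); ring.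
Qed.

(** The edges from vertex 0 span space; their coefficients in the expansion of
    the d-th unit vector are the partial derivatives of the coordinates. *)
Lemma mderiv_edges d p :
  mderiv d p = \sum_j N (lift ord0 d) j *: dderiv (edge j ord0) p.
Proof.
rewrite /dderiv; under eq_bigr do rewrite scaler_sumr.
rewrite exchange_big /= (bigD1 d)//= [X in _ + X]big1 => [|c cd].
  rewrite addr0; under eq_bigr do rewrite scalerA mulrC mulrBl.
  by rewrite -scaler_suml sumrB gradient_vertices -mulr_sumr gradient_sum mulr0 subr0 eqxx scale1r.
under eq_bigr do rewrite scalerA mulrC mulrBl.
by rewrite -scaler_suml sumrB gradient_vertices -mulr_sumr gradient_sum mulr0 subr0 eq_sym
  (negbTE cd) scale0r.
Qed.

(** Each variable is a linear form in the barycentric coordinates, and so is 1,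
    their sum.  A monomial of degree at most m, padded with factors 1, is thus a
    product of m linear forms, to be expanded by multilinearity.  Stated as an
    induction principle: a linear property of polynomials can be checked on
    products of m coordinates. *)
Lemma lam_span (D : P -> Prop) m :
  D 0 -> (forall a p q, D p -> D q -> D (a *: p + q)) ->
  (forall s : seq 'I_4, size s = m -> D (\prod_(i <- s) lam i)) ->
  forall p, Pdeg m p -> D p.
Proof.
move=> D0 Dlin Dprod.
have Dscale a p : D p -> D (a *: p).
  by move=> Dp; rewrite -[_ *: _]addr0; exact: Dlin.
have Dsum (I : Type) (r : seq I) (F : I -> P) :
    (forall i, D (F i)) -> D (\sum_(i <- r) F i).
  move=> DF; elim: r => [|i r IH]; first by rewrite big_nil.
  by rewrite big_cons -[F i]scale1r; exact: Dlin.
(* The factors of the first product are expanded one at a time into the second. *)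
have Dforms (f : seq ('I_4 -> R)) : forall s, (size f + size s = m)%N ->
    D (\prod_(t <- f) (\sum_i t i *: lam i) * \prod_(i <- s) lam i).
  elim: f => [|t f IH] s szs; first by rewrite big_nil mul1r; exact: Dprod.
  rewrite big_cons -mulrA mulr_suml; apply: Dsum => i.
  rewrite -scalerAl mulrCA; apply: Dscale.
  have := IH (i :: s); rewrite big_cons; apply.
  by rewrite -szs /= addnS.
have lift_max : lift ord0 (lift ord0 ord0) = ord_max :> 'I_3 by apply: val_inj.
have one_lam : \sum_i (fun=> 1) i *: lam i = 1.
  by under eq_bigr do rewrite scale1r; rewrite sum_lam.
have constt_prod k (t : 'I_4 -> R) :
    \prod_(t <- nseq k t) (\sum_i t i *: lam i) = (\sum_i t i *: lam i) ^+ k.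
  by rewrite big_nseq; elim: k => [|k IH] //=; rewrite IH exprS.
move=> p pm; rewrite [p]mpolyE; apply: Dsum => w.
have [mw|wm] := ltnP m (mdeg w).
  by move/Pdeg_coef: pm => ->//; rewrite scale0r.
apply: Dscale.
pose f := nseq (w ord0) (V^~ ord0) ++ nseq (w (lift ord0 ord0)) (V^~ (lift ord0 ord0))
  ++ nseq (w ord_max) (V^~ ord_max) ++ nseq (m - mdeg w) (fun=> 1).
have szf : (size f + size ([::] : seq 'I_4) = m)%N.
  rewrite /f !size_cat !size_nseq addn0 -[RHS](subnKC wm) mdegE !big_ord_recl big_ord0.
  by rewrite !addn0 lift_max !addnA.
have := Dforms _ _ szf; rewrite big_nil mulr1 /f !big_cat /= !constt_prod.
rewrite one_lam expr1n mulr1 -!var_lam [mpolyX R w]mpolyXE_id !big_ord_recl big_ord0 mulr1.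
by rewrite lift_max.
Qed.

End Coordinates.

End Barycentric.

(** * Integrals of barycentric monomials over the tetrahedron and its faces *)
Section Integrals.
Variable R : realType.
Variable V : 'M[R]_(4, 3).
Hypothesis hV : nondegenerate_tet V.
Local Notation P := (poly3 R).
Local Notation mu := (@lebesgue_measure R).
Local Notation bR := (measurableTypeR R).
Local Notation mu3 := (mu \x mu \x mu)%E.
Local Notation N := (invmx (homogeneous_vertices V)).
Local Notation lam := (lam V).

Lemma tetrahedronP x : tetrahedron V x <-> forall i, 0 <= peval (lam i) x.
Proof.
split=> [[l [l0 l1 ->]] i|x0]; first by rewrite (peval_lam_comb hV)// l0.
by exists (fun i => peval (lam i) x); split=> //; [exact: sum_peval_lam|exact: lam_vertices].
Qed.

Lemma peval_lam_le1 i x : tetrahedron V x -> peval (lam i) x <= 1.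
Proof.
move=> /tetrahedronP x0; rewrite -(sum_peval_lam hV x) (bigD1 i)//= lerDl.
exact: sumr_ge0.
Qed.

(** On the tetrahedron the coordinates lie between 0 and 1, hence so do their
    products. *)
Lemma peval_bounded (p : P) : exists M, forall x, tetrahedron V x -> `|peval p x| <= M.
Proof.
apply: (lam_span hV (D := fun p => exists M, forall x, tetrahedron V x -> `|peval p x| <= M)
   (m := msize p)).
- by exists 0 => x _; rewrite /peval meval0 normr0.
- move=> a q r [A hA] [B hB]; exists (`|a| * A + B) => x Tx.
  rewrite /peval mevalD mevalZ (le_trans (ler_normD _ _))// lerD//; last exact: hB.
  by rewrite normrM ler_wpM2l//; exact: hA.
- move=> s _; exists 1 => x Tx; elim: s => [|i s IH].
    by rewrite big_nil /peval meval1 normr1.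
  rewrite big_cons /peval mevalM normrM mulr_ile1//.
  by have /tetrahedronP x0 := Tx; rewrite ger0_norm ?peval_lam_le1 ?x0.
- by rewrite /Pdeg /= leqnSn.
Qed.

Lemma measurable_peval d (T : measurableType d) (g : T -> 'rV[R]_3) (p : P) :
  (forall i, measurable_fun setT (fun t => g t ord0 i)) ->
  measurable_fun setT (fun t => peval p (g t)).
Proof.
move=> mg; rewrite /peval.
under eq_fun do rewrite mevalE.
apply: measurable_sum => w; apply: measurable_funM => //.
apply: measurable_prod => i _; exact: measurable_funX.
Qed.

Lemma measurable_pt3 i : measurable_fun setT (fun w : bR * bR * bR => pt3 w ord0 i : R).
Proof.
under eq_fun do rewrite mxE.
case: i => -[|[|[|//]]] ? /=;
  [exact: measurableT_comp|exact: measurableT_comp|exact: measurable_snd].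
Qed.

Local Notation i1 := (lift ord0 ord0 : 'I_4).
Local Notation i2 := (lift ord0 (lift ord0 ord0) : 'I_4).
Local Notation i3 := (lift ord0 (lift ord0 (lift ord0 ord0)) : 'I_4).

Lemma peval_lam0 x :
  peval (lam ord0) x = 1 - peval (lam i1) x - peval (lam i2) x - peval (lam i3) x.
Proof.
have := sum_peval_lam hV x; rewrite !big_ord_recl big_ord0 => <-; ring.
Qed.

(** The affine map carrying the tetrahedron to the reference one. *)
Definition bary_map (w : bR * bR * bR) : bR * bR * bR :=
  (peval (lam i1) (pt3 w), peval (lam i2) (pt3 w), peval (lam i3) (pt3 w)).

Lemma preimage_reference_tet :
  bary_map @^-1` (@reference_tet R) = (@pt3 R) @^-1` tetrahedron V.
Proof.
apply/seteqP; split => w /=.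
  move=> -[/= h1 h2 h3 h0]; apply/tetrahedronP => i.
  case: (unliftP ord0 i) => [j ->|->]; last by rewrite peval_lam0.
  case: (unliftP ord0 j) => [k ->|-> //].
  by case: (unliftP ord0 k) => [l ->|-> //]; rewrite (ord1 l).
by move=> /tetrahedronP h; split; rewrite /= ?h// -peval_lam0.
Qed.

(** The gradients of three barycentric coordinates are dual to the edges from
    vertex 0, so their determinant times that of the edges is 1. *)
Lemma bary_scales : exists c, scales_measure mu3 c bary_map.
Proof.
pose g (i : 'I_4) : R * R * R :=
  (N (lift ord0 ord0) i, N (lift ord0 (lift ord0 ord0)) i,
   N (lift ord0 (lift ord0 (lift ord0 ord0))) i).
pose e (j : 'I_4) : R * R * R :=
  (V j ord0 - V ord0 ord0, V j (lift ord0 ord0) - V ord0 (lift ord0 ord0),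
   V j (lift ord0 (lift ord0 ord0)) - V ord0 (lift ord0 (lift ord0 ord0))).
pose dot (u v : R * R * R) := u.1.1 * v.1.1 + u.1.2 * v.1.2 + u.2 * v.2.
have ge (i : 'I_4) (j : 'I_4) : dot (g i) (e j) = (j == i)%:R - (ord0 == i)%:R.
  rewrite -!(vertex_kronecker hV) !big_ord_recl !big_ord0 /dot /=; ring.
have d0 : det3 (g i1) (g i2) (g i3) != 0.
  suff : det3 (g i1) (g i2) (g i3) * det3 (e i1) (e i2) (e i3) = 1.
    by move=> h; apply/eqP => g0; move: h; rewrite g0 mul0r => /eqP; rewrite eq_sym oner_eq0.
  pose row i := (dot (g i) (e i1), dot (g i) (e i2), dot (g i) (e i3)).
  transitivity (det3 (row i1) (row i2) (row i3)).
    rewrite /row; case: (g i1) (g i2) (g i3) (e i1) (e i2) (e i3)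
      => [[a0 a1] a2] [[b0 b1] b2] [[c0 c1] c2] [[x0 x1] x2] [[y0 y1] y2] [[z0 z1] z2].
    by rewrite /det3 /minor2 /dot /=; ring.
  by rewrite /row !ge /det3 /minor2 /=; ring.
have [c hc] := volume_coordinates_affine (N ord0 i1) (N ord0 i2) (N ord0 i3) d0.
exists c; move: hc; congr (scales_measure _ _ _); apply/funext => w.
by rewrite /bary_map /affine_form !peval_lam !big_ord_recl !big_ord0 !mxE /=;
  congr (_, _, _); ring.
Qed.

(** The constant is 6 times the volume, as the exponents 0 show. *)
Lemma volume_dirichlet : exists2 k : R, 0 < k & forall a b c e : nat,
  (\int[mu3]_(w in (@pt3 R) @^-1` tetrahedron V)
     (peval (lam ord0 ^+ a * lam i1 ^+ b * lam i2 ^+ c * lam i3 ^+ e) (pt3 w))%:E =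
   (k * (a`!%:R * b`!%:R * c`!%:R * e`!%:R / (a + b + c + e).+3`!%:R))%:E)%E.
Proof.
have [k hk] := bary_scales; exists k; first by case: hk.
move=> a b c e.
have f0 p : @reference_tet R p -> 0 <= (1 - p.1.1 - p.1.2 - p.2) ^+ a *
      p.1.1 ^+ b * p.1.2 ^+ c * p.2 ^+ e :> R.
  by move=> [? ? ? ?]; rewrite !mulr_ge0 ?exprn_ge0.
have := scales_integral hk (@measurable_reference_tet R)
  (measurable_funTS (@measurable_dirichlet3 R a b c e)) f0.
rewrite preimage_reference_tet dirichlet_tet -EFinM => <-.
apply: eq_integral => w _; congr EFin.
by rewrite /peval !mevalM !rmorphXn /= -!/(peval _ _) peval_lam0.
Qed.

Lemma measurable_tet : measurable ((@pt3 R) @^-1` tetrahedron V : set (bR * bR * bR)).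
Proof.
rewrite -preimage_reference_tet -[X in measurable X]setTI.
have [k [mbary _ _]] := bary_scales; apply: mbary => //.
exact: measurable_reference_tet.
Qed.

Lemma bounded_integrable d (T : measurableType d) (m : {measure set T -> \bar R})
    (A : set T) (f : T -> R) M :
  measurable A -> (m A < +oo)%E -> measurable_fun setT f ->
  (forall x, A x -> `|f x| <= M) -> m.-integrable A (EFin \o f).
Proof.
move=> mA Afin mf fM; apply: measurable_bounded_integrable => //.
  exact: measurable_funTS.
exists M; split; first exact: num_real.
by move=> x Mx y Ay; exact: le_trans (fM _ Ay) (ltW Mx).
Qed.

Lemma integrable_tet (p : P) :
  mu3.-integrable ((@pt3 R) @^-1` tetrahedron V) (EFin \o (fun w => peval p (pt3 w))).
Proof.
have [M pM] := peval_bounded p.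
apply: (@bounded_integrable _ _ _ _ _ M) => //.
- exact: measurable_tet.
- have [k _ /(_ 0 0 0 0)%N] := volume_dirichlet.
  rewrite (eq_integral (fun=> 1%E)) => [|w _].
    by rewrite integral_cst ?mul1e => [->|]; [rewrite ltry|exact: measurable_tet].
  by rewrite !expr0 !mulr1 /peval meval1.
- by apply: measurable_peval; exact: measurable_pt3.
- by move=> w; exact: pM.
Qed.

Lemma integral_tet_linear a (p q : P) :
  integral_tet V (a *: p + q) = a * integral_tet V p + integral_tet V q.
Proof.
rewrite /integral_tet -RintegralZl; [|exact: measurable_tet|exact: integrable_tet].
rewrite -RintegralD; first last.
- exact: integrable_tet.
- have := integrable_tet (a *: p); apply: eq_ind; congr (integrable _ _ _).
  by apply/funext => w /=; rewrite /peval mevalZ.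
- exact: measurable_tet.
by apply: eq_Rintegral => w _; rewrite /peval mevalD mevalZ.
Qed.

Lemma integral_tet_dirichlet : exists2 k : R, 0 < k & forall a b c e : nat,
  integral_tet V (lam ord0 ^+ a * lam i1 ^+ b * lam i2 ^+ c * lam i3 ^+ e) =
  k * (a`!%:R * b`!%:R * c`!%:R * e`!%:R / (a + b + c + e).+3`!%:R).
Proof.
have [k k0 kE] := volume_dirichlet; exists k => // a b c e.
by rewrite /integral_tet /Rintegral kE.
Qed.

Local Notation triangle := (@reference_triangle R : set (bR * bR)).

(** Barycentric coordinates on the reference triangle; entry [j] is carried to
    the vertex [lift f j] by the parametrization of the face [f]. *)
Definition triangle_bary (u : R * R) (j : 'I_3) : R :=
  [:: 1 - u.1 - u.2; u.1; u.2]`_j.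

Lemma face_paramE f u :
  face_param V f u = \sum_j triangle_bary u j *: row (lift f j) V.
Proof.
rewrite /face_param /face_edges /face_vertex !big_ord_recl big_ord0.
have -> : @ord_max 1 = lift ord0 ord0 by apply: val_inj.
rewrite !rowK /triangle_bary /= !scalerBl !scalerBr scale1r.
apply/rowP => i; rewrite !mxE; ring.
Qed.

Lemma peval_lam_face f u i : peval (lam i) (face_param V f u) =
  if unlift f i is Some j then triangle_bary u j else 0.
Proof.
have -> : face_param V f u =
    \sum_i (if unlift f i is Some j then triangle_bary u j else 0) *: row i V.
  rewrite face_paramE (bigD1_ord f) //= unlift_none scale0r add0r.
  by apply: eq_bigr => j _; rewrite liftK.
rewrite (peval_lam_comb hV)// (bigD1_ord f) //= unlift_none add0r.
under eq_bigr do rewrite liftK.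
by rewrite !big_ord_recl big_ord0 /triangle_bary /=; ring.
Qed.

(** The face integral without the area factor of the parametrization, a positive
    constant: the condition defining bubbles does not see it, and the formulas
    for barycentric monomials become the same on all faces. *)
Definition face_integral f (p : P) : R :=
  (\int[(mu \x mu)%E]_(u in triangle) peval p (face_param V f u))%R.

Lemma triangle_bary_ge0 u j : triangle u -> 0 <= triangle_bary u j.
Proof.
by move=> [? ? ?]; case: j => -[|[|[|//]]] ?; rewrite /triangle_bary /=; lra.
Qed.

Lemma face_tetrahedron f u : triangle u -> tetrahedron V (face_param V f u).
Proof.
move=> uT; apply/tetrahedronP => i; rewrite peval_lam_face.
by case: unliftP => // j _; exact: triangle_bary_ge0.
Qed.

Lemma measurable_face_param f i :
  measurable_fun setT (fun u : bR * bR => face_param V f u ord0 i : R).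
Proof.
under eq_fun do rewrite !mxE.
by apply: measurable_funD; [apply: measurable_funD => //|]; exact: measurable_funM.
Qed.

Lemma integrable_face f (p : P) :
  (mu \x mu)%E.-integrable triangle (EFin \o (fun u => peval p (face_param V f u))).
Proof.
have [M pM] := peval_bounded p.
apply: (@bounded_integrable _ _ _ _ _ M) => //.
- exact: measurable_triangle.
- have := dirichlet_triangle R 0 0 0.
  rewrite (eq_integral (fun=> 1%E)) => [|w _]; last by rewrite !expr0 !mulr1.
  by rewrite integral_cst ?mul1e => [->|]; [rewrite ltry|exact: measurable_triangle].
- by apply: measurable_peval; exact: measurable_face_param.
- by move=> u uT; apply/pM/face_tetrahedron.
Qed.

Lemma face_integral_linear f a (p q : P) :
  face_integral f (a *: p + q) = a * face_integral f p + face_integral f q.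
Proof.
rewrite /face_integral -RintegralZl; [|exact: measurable_triangle|exact: integrable_face].
rewrite -RintegralD; first last.
- exact: integrable_face.
- have := integrable_face f (a *: p); apply: eq_ind; congr (integrable _ _ _).
  by apply/funext => w /=; rewrite /peval mevalZ.
- exact: measurable_triangle.
by apply: eq_Rintegral => w _; rewrite /peval mevalD mevalZ.
Qed.

Definition lam_monomial (e : 'I_4 -> nat) : P := \prod_i lam i ^+ e i.

Definition multifactorial n (e : 'I_n -> nat) : R := (\prod_i (e i)`!)%:R.

Lemma integral_tet_monomial : exists2 k : R, 0 < k & forall e,
  integral_tet V (lam_monomial e) = k * (multifactorial e / (\sum_i e i).+3`!%:R).
Proof.
have [k k0 kE] := integral_tet_dirichlet; exists k => // e.
have := kE (e ord0) (e i1) (e i2) (e i3).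
rewrite /lam_monomial /multifactorial !big_ord_recl !big_ord0 mulr1 addn0 muln1 !natrM.
by rewrite !mulrA !addnA.
Qed.

Lemma face_integral_monomial f e : face_integral f (lam_monomial e) =
  if e f == 0%N then multifactorial e / (\sum_i e i).+2`!%:R else 0.
Proof.
have pE u : peval (lam_monomial e) (face_param V f u) =
    0 ^+ e f * \prod_j triangle_bary u j ^+ e (lift f j).
  rewrite /lam_monomial /peval rmorph_prod /= (bigD1_ord f)//= rmorphXn /= -/(peval _ _).
  rewrite peval_lam_face unlift_none; congr (_ * _); apply: eq_bigr => j _.
  by rewrite rmorphXn /= -/(peval _ _) peval_lam_face liftK.
rewrite /face_integral; under eq_Rintegral do rewrite pE.
case: eqP => [ef|/eqP ef]; last first.
  rewrite expr0n (negbTE ef); under eq_Rintegral do rewrite mul0r.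
  by rewrite Rintegral_cst ?mul0r//; exact: measurable_triangle.
rewrite /multifactorial !(bigD1_ord f)//= ef expr0 mul1n add0n !big_ord_recl !big_ord0.
rewrite muln1 addn0 2!natrM /Rintegral.
have /(congr1 fine) := dirichlet_triangle R (e (lift f ord0))
  (e (lift f (lift ord0 ord0))) (e (lift f (lift ord0 (lift ord0 ord0)))).
rewrite [fine _%:E]/= -!mulrA !addnA => <-.
congr fine; apply: eq_integral => u _; congr EFin.
by rewrite !big_ord_recl big_ord0 mul1r mulr1 /triangle_bary /= !mulrA.
Qed.

End Integrals.

(** * The divergence theorem on a tetrahedron *)
Section Divergence.
Variable R : realType.
Variable V : 'M[R]_(4, 3).
Hypothesis hV : nondegenerate_tet V.
Local Notation P := (poly3 R).
Local Notation N := (invmx (homogeneous_vertices V)).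
Local Notation lam := (lam V).
Local Notation lam_monomial := (lam_monomial V).

Lemma prod_lam_count (s : seq 'I_4) :
  \prod_(i <- s) lam i = lam_monomial (fun i => count_mem i s).
Proof.
elim: s => [|x s IH]; first by rewrite big_nil /lam_monomial big1// => i _; rewrite expr0.
rewrite big_cons IH /lam_monomial.
under [RHS]eq_bigr do rewrite /= exprD.
rewrite big_split /=; congr (_ * _).
rewrite (bigD1 x)//= eqxx expr1 big1 ?mulr1// => i ix.
by rewrite eq_sym (negbTE ix) expr0.
Qed.

Definition lower_exponent (j : 'I_4) (e : 'I_4 -> nat) i := if i == j then (e i).-1 else e i.

(** Along V_j - V_l, the coordinates j and l have derivatives 1 and -1 and the
    two others are constant. *)
Lemma dderiv_monomial j l e : j != l -> dderiv (edge V j l) (lam_monomial e) =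
  (e j)%:R *: lam_monomial (lower_exponent j e) - (e l)%:R *: lam_monomial (lower_exponent l e).
Proof.
(* The Leibniz rule, with x, y for the powers of coordinates j, l; x1, y1 for
   these powers lowered by one; and m for the rest of the monomial. *)
have key (A : comNzRingType) (a b x x1 y y1 m : A) :
    a * x1 * (1 - 0) * (y * m) + x * (b * y1 * (0 - 1) * m + y * 0) =
    a * (x1 * (y * m)) - b * (x * (y1 * m)) by ring.
move=> jl; pose M := \prod_(i | (i != j) && (i != l)) lam i ^+ e i.
have E e' : (forall i, i != j -> i != l -> e' i = e i) ->
    lam_monomial e' = lam j ^+ e' j * (lam l ^+ e' l * M).
  move=> e'E; rewrite /lam_monomial (bigD1 j)//= (bigD1 l) 1?eq_sym//=; congr (_ * (_ * _)).
  by apply: eq_bigr => i /andP[ij il]; rewrite e'E.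
have DM : dderiv (edge V j l) M = 0.
  rewrite /M; elim/big_ind: _ => [|p q Dp Dq|i /andP[ij il]]; first exact: dderiv1.
    by rewrite dderivM Dp Dq mul0r mulr0 addr0.
  by rewrite dderivX dderiv_lam // ![_ == i]eq_sym (negbTE ij) (negbTE il) subrr mulr0.
have lj : l == j = false by rewrite eq_sym (negbTE jl).
rewrite (E e)// (E (lower_exponent j e)) => [|i /negbTE ij _]; last by rewrite /lower_exponent ij.
rewrite (E (lower_exponent l e)) => [|i _ /negbTE il]; last by rewrite /lower_exponent il.
rewrite /lower_exponent !eqxx lj (negbTE jl) !dderivM !dderivX DM !dderiv_lam// !eqxx lj (negbTE jl).
have natZ n (p : P) : n%:R *: p = n%:R * p by rewrite scaler_nat mulr_natl.
by rewrite !natZ; exact: key.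
Qed.

Lemma sum_lower_exponent j e : (0 < e j)%N ->
  (\sum_i e i = (\sum_i lower_exponent j e i).+1)%N.
Proof.
move=> ej; rewrite (bigD1 j)//= [in RHS](bigD1 j)//= /lower_exponent eqxx -addSn.
rewrite prednK//; congr (_ + _)%N.
by apply: eq_bigr => i /negbTE ->.
Qed.

Lemma multifactorial_lower_exponent j e : (0 < e j)%N ->
  multifactorial R e = (e j)%:R * multifactorial R (lower_exponent j e).
Proof.
move=> ej; rewrite /multifactorial -natrM (bigD1 j)//= [in RHS](bigD1 j)//= /lower_exponent eqxx.
rewrite mulnA; congr (_ * _)%:R.
rewrite -[in LHS](prednK ej) factS prednK//; congr (_ * _)%N.
by apply: eq_bigr => i /negbTE ->.
Qed.

Lemma integral_tet0 : integral_tet V 0 = 0.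
Proof.
have := integral_tet_linear hV (-1) 0 0.
by rewrite scaler0 addr0 mulN1r addNr.
Qed.

Lemma integral_tetZ a p : integral_tet V (a *: p) = a * integral_tet V p.
Proof. by have := integral_tet_linear hV a p 0; rewrite !addr0 integral_tet0 addr0. Qed.

Lemma face_integral0 f : face_integral V f 0 = 0.
Proof.
have := face_integral_linear hV f (-1) 0 0.
by rewrite scaler0 addr0 mulN1r addNr.
Qed.

(** On a monomial l^e with c = e! / (|e| + 2)!, lowering the exponent of l_i and
    multiplying by e_i gives a polynomial of integral k c over T if e_i > 0, and
    0 otherwise.  In both cases this is k (c - int_(F_i) l^e), since the face
    integral vanishes in the first case and is c in the second.  In the
    difference for j and l the two c cancel. *)
Lemma integral_tet_dderiv : exists2 k : R, 0 < k & forall p j l, j != l ->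
  integral_tet V (dderiv (edge V j l) p) = k * (face_integral V l p - face_integral V j p).
Proof.
have [k k0 kE] := integral_tet_monomial hV; exists k => // p j l jl.
have lower_int i e : integral_tet V ((e i)%:R *: lam_monomial (lower_exponent i e)) =
    k * (multifactorial R e / (\sum_i e i).+2`!%:R - face_integral V i (lam_monomial e)).
  rewrite face_integral_monomial//; case: eqP => [->|/eqP ei].
    by rewrite subrr mulr0 scale0r integral_tet0.
  rewrite -lt0n in ei; rewrite subr0 integral_tetZ kE (multifactorial_lower_exponent ei).
  by rewrite (sum_lower_exponent ei); ring.
apply: (lam_span hV (m := msize p) (D := fun p => integral_tet V (dderiv (edge V j l) p) =
    k * (face_integral V l p - face_integral V j p))).
- rewrite !face_integral0 subrr mulr0 -[RHS]integral_tet0; congr (integral_tet V _).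
  by rewrite /dderiv big1// => d _; rewrite raddf0 scaler0.
- move=> a q r qE rE; rewrite dderiv_linear integral_tet_linear// qE rE.
  rewrite (face_integral_linear hV l a) (face_integral_linear hV j a).
  move: (face_integral V l q) (face_integral V l r) (face_integral V j q)
    (face_integral V j r) => *.
  ring.
- move=> s _; rewrite prod_lam_count dderiv_monomial//.
  rewrite -scaleN1r addrC integral_tet_linear// !lower_int.
  move: (face_integral V l _) (face_integral V j _) => *; ring.
- by rewrite /Pdeg /= leqnSn.
Qed.

Lemma lam_gradient_edge i j l :
  \sum_d N (lift ord0 d) i * (V j d - V l d) = (j == i)%:R - (l == i)%:R.
Proof.
under eq_bigr do rewrite mulrBr; rewrite sumrB -!(vertex_kronecker hV) opprD addrACA subrr add0r.
by congr (_ - _); apply: eq_bigr => d _; rewrite mulrC.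
Qed.

Lemma det_mx2 (A : 'M[R]_2) :
  \det A = A ord0 ord0 * A ord_max ord_max - A ord0 ord_max * A ord_max ord0.
Proof.
have max1 : @ord_max 1 = lift ord0 ord0 by apply: val_inj.
rewrite (expand_det_row _ ord0) !big_ord_recl big_ord0 /cofactor !det_mx11 !mxE max1.
have -> : lift (lift ord0 (ord0 : 'I_1)) (ord0 : 'I_1) = ord0 :> 'I_2 by apply: val_inj.
by rewrite /= expr0 expr1; ring.
Qed.

(** By Lagrange's identity the Gram determinant is the squared norm of the cross
    product a x b, and the dual basis gives (g x h) . (a x b) = 1. *)
Lemma gram_gt0 (a b g h : 'I_3 -> R) :
  \sum_d g d * a d = 1 -> \sum_d g d * b d = 0 ->
  \sum_d h d * a d = 0 -> \sum_d h d * b d = 1 ->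
  0 < (\sum_d a d * a d) * (\sum_d b d * b d) - (\sum_d a d * b d) * (\sum_d b d * a d).
Proof.
rewrite !big_ord_recl !big_ord0 !addr0.
move: (a ord0) (a (lift ord0 ord0)) (a (lift ord0 (lift ord0 ord0)))
  (b ord0) (b (lift ord0 ord0)) (b (lift ord0 (lift ord0 ord0)))
  (g ord0) (g (lift ord0 ord0)) (g (lift ord0 (lift ord0 ord0)))
  (h ord0) (h (lift ord0 ord0)) (h (lift ord0 (lift ord0 ord0)))
  => a0 a1 a2 b0 b1 b2 g0 g1 g2 h0 h1 h2 ga gb ha hb.
pose c0 := a1 * b2 - a2 * b1; pose c1 := a2 * b0 - a0 * b2.
pose c2 := a0 * b1 - a1 * b0.
have -> : (a0 * a0 + (a1 * a1 + a2 * a2)) * (b0 * b0 + (b1 * b1 + b2 * b2)) -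
    (a0 * b0 + (a1 * b1 + a2 * b2)) * (b0 * a0 + (b1 * a1 + b2 * a2)) =
    c0 ^+ 2 + c1 ^+ 2 + c2 ^+ 2 by rewrite /c0 /c1 /c2; ring.
have gh : (g1 * h2 - g2 * h1) * c0 + (g2 * h0 - g0 * h2) * c1 +
    (g0 * h1 - g1 * h0) * c2 = 1.
  transitivity ((g0 * a0 + (g1 * a1 + g2 * a2)) * (h0 * b0 + (h1 * b1 + h2 * b2)) -
      (g0 * b0 + (g1 * b1 + g2 * b2)) * (h0 * a0 + (h1 * a1 + h2 * a2))).
    by rewrite /c0 /c1 /c2; ring.
  by rewrite ga gb ha hb; ring.
rewrite lt_neqAle !addr_ge0 ?sqr_ge0// andbT eq_sym.
apply/eqP => /eqP; rewrite !paddr_eq0 ?addr_ge0 ?sqr_ge0// !sqrf_eq0.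
move=> /andP[/andP[/eqP z0 /eqP z1] /eqP z2].
by move/eqP: gh; rewrite z0 z1 z2 !mulr0 !addr0 eq_sym oner_eq0.
Qed.

(** The dual basis consists of the gradients of two coordinates of the face. *)
Lemma face_gram_gt0 f : 0 < \det (face_edges V f *m (face_edges V f)^T).
Proof.
have max1 : @ord_max 1 = lift ord0 ord0 by apply: val_inj.
have gE i r : \sum_d N (lift ord0 d) (lift f i) * face_edges V f r d =
    (lift ord0 r == i)%:R - (ord0 == i)%:R.
  under eq_bigr do rewrite !mxE.
  by rewrite lam_gradient_edge !(inj_eq lift_inj).
rewrite det_mx2 !mxE.
under [X in X * _ - _]eq_bigr do rewrite [X in _ * X]mxE.
under [X in _ * X - _]eq_bigr do rewrite [X in _ * X]mxE.
under [X in _ - X * _]eq_bigr do rewrite [X in _ * X]mxE.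
under [X in _ - _ * X]eq_bigr do rewrite [X in _ * X]mxE.
apply: (gram_gt0 (g := fun d => N (lift ord0 d) (lift f (lift ord0 ord0)))
  (h := fun d => N (lift ord0 d) (lift f (lift ord0 (lift ord0 ord0)))));
  by rewrite gE ?max1 ?subr0 ?subrr.
Qed.

Lemma integral_faceE f p : integral_face V f p =
  Num.sqrt (\det (face_edges V f *m (face_edges V f)^T)) * face_integral V f p.
Proof. by []. Qed.

Lemma bubble_face_integral k v f q :
  bubble V k v -> Pdeg k.-1 q -> face_integral V f (v * q) = 0.
Proof.
move=> [_ /(_ q f) h] /h /eqP; rewrite /integral_face mulf_eq0 sqrtr_eq0.
by rewrite leNgt face_gram_gt0 /= => /eqP.
Qed.

(** Partial derivatives are combinations of derivatives along edges, which
    integrate to differences of face integrals; those of a bubble are zero, as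
    seen by testing against the constant 1. *)
Lemma divergence_P0perp k v : vbubble V k v -> P0perp V k (divergence v).
Proof.
move=> vb; split.
  by rewrite /divergence; apply: Pdeg_sum => i; apply: Pdeg_mderiv; case: (vb i).
have [c c0 cE] := integral_tet_dderiv.
rewrite /divergence.
have Lsum (I : Type) (r : seq I) (F : I -> P) :
    (forall i, integral_tet V (F i) = 0) -> integral_tet V (\sum_(i <- r) F i) = 0.
  move=> F0; elim/big_ind: _ => [|p q p0 q0|i _]; [exact: integral_tet0| |exact: F0].
  by rewrite -[p]scale1r integral_tet_linear// p0 q0 mulr0 addr0.
apply/Lsum => i; rewrite (mderiv_edges hV); apply/Lsum => j.
rewrite integral_tetZ; have [->|j0] := eqVneq j ord0.
  rewrite /dderiv big1 ?integral_tet0 ?mulr0// => d _.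
  by rewrite /edge subrr scale0r.
have fm f : face_integral V f (v i) = 0.
  rewrite -[v i]mulr1; apply: bubble_face_integral (vb i) _.
  by rewrite -mpolyC1; exact: PdegC.
by rewrite cE// !fm subrr !mulr0.
Qed.

End Divergence.

(** * Generating quadratic and cubic products *)
Lemma ord4_complete (i j : 'I_4) : i != j -> exists l m, uniq [:: i; j; l; m].
Proof.
move=> ij; have Cij : #|~: [set i; j]| == 2%N.
  by have := cardsC [set i; j]; rewrite cards2 ij card_ord; case: #|_| => [|[|[|?]]].
have /cards2P[l [m [lm ijC]]] := Cij.
have mem h : (h \in [:: l; m]) = (h \notin [:: i; j]).
  by have := finset.in_setC h [set i; j]; rewrite ijC !inE.
exists l, m; rewrite /= !inE !negb_or ij lm !andbT /=.
have := mem l; have := mem m; rewrite !inE !eqxx orbT /= !negb_or.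
by rewrite ![_ == l]eq_sym ![_ == m]eq_sym => /esym/andP[-> ->] /esym/andP[-> ->].
Qed.

Lemma big_ord4 (A : Type) (idx : A) (op : Monoid.com_law idx) (F : 'I_4 -> A)
    (i j l m : 'I_4) : uniq [:: i; j; l; m] ->
  \big[op/idx]_h F h = op (op (op (F i) (F j)) (F l)) (F m).
Proof.
move=> u; have [_ mem] := uniq_min_size u (s2 := enum 'I_4)
  (fun h _ => mem_enum 'I_4 h) (eq_leq (size_enum_ord 4)).
rewrite -big_enum (perm_big [:: i; j; l; m]) /=; last first.
  by rewrite uniq_perm ?enum_uniq// => h; rewrite mem.
by rewrite !big_cons big_nil Monoid.mulm1 !Monoid.mulmA.
Qed.

Lemma sum_ord4 (A : nmodType) (F : 'I_4 -> A) (i j l m : 'I_4) :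
  uniq [:: i; j; l; m] -> \sum_h F h = F i + F j + F l + F m.
Proof. exact: big_ord4. Qed.

Lemma uniq4_swap12 (T : eqType) (i j l m : T) :
  uniq [:: i; j; l; m] -> uniq [:: j; i; l; m].
Proof.
by rewrite (@perm_uniq _ _ [:: j; i; l; m])//; apply/permP => p /=; rewrite addnCA.
Qed.

Lemma uniq4_swap23 (T : eqType) (i j l m : T) :
  uniq [:: i; j; l; m] -> uniq [:: i; l; j; m].
Proof.
by rewrite (@perm_uniq _ _ [:: i; l; j; m])//; apply/permP => p /=; congr (_ + _)%N; rewrite addnCA.
Qed.

Lemma uniq4_swap34 (T : eqType) (i j l m : T) :
  uniq [:: i; j; l; m] -> uniq [:: i; j; m; l].
Proof.
by rewrite (@perm_uniq _ _ [:: i; j; m; l])//; apply/permP => p /=;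
  rewrite !addn0 [(p l + p m)%N]addnC.
Qed.

(** Pure algebra: [D] stands for the divergences of bubble fields plus constants
    and [x] for the barycentric coordinates.   Congruences are modulo [D], p_n is
    the sum of the n-th powers of the [x i], and the coordinate [d], eliminated
    by [sum_x], makes each linear combination below a ring identity. *)
Section Generation.
Variable A : comNzRingType.
Variable D : A -> Prop.
Hypothesis DB : forall p q, D p -> D q -> D (p - q).
Hypothesis Dnat : forall n p, D p -> D (n%:R * p).
Hypothesis Ddiv : forall n p, D (n.+1%:R * p) -> D p.
Variable x : 'I_4 -> A.
Hypothesis sum_x : \sum_i x i = 1.
Hypothesis D1 : D 1.

Let D0 : D 0.
Proof. by rewrite -(subrr 1); exact: DB. Qed.

Let DN p : D p -> D (- p).
Proof. by rewrite -sub0r; exact: DB. Qed.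

Let DD p q : D p -> D q -> D (p + q).
Proof. by move=> Dp Dq; rewrite -[q]opprK; exact/DB/DN. Qed.

Let Dcomb n p q : D q -> n.+1%:R * p = q -> D p.
Proof. by move=> Dq pq; apply: (Ddiv (n := n)); rewrite pq. Qed.

(** By the second family, products of two different coordinates are congruent
    when they share an index, hence all congruent to each other.  Summing the
    first family over i gives 15 p_2 - 10, which is 5 minus 30 times the sum of
    the six products, so 180 times any one of them is in [D].  The squares then
    follow from x_i = x_i (x_0 + x_1 + x_2 + x_3) and the first family. *)
Lemma quadratic_generation :
  (forall i, D (15 * x i ^+ 2 - 10 * x i)) ->
  (forall i j l, j != i -> l != i -> D (6 * (x i * (x j - x l)))) ->
  forall i j, D (x i * x j).
Proof.
move=> Dg DA.
have Deq i j l : j != i -> l != i -> D (x i * (x j - x l)).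
  by move=> ji li; apply: (Ddiv (n := 5)); exact: DA.
have Dne i j : i != j -> D (x i * x j).
  move=> /ord4_complete[l [m u]].
  have := u; rewrite /= !inE !negb_or => /and4P[/and3P[ij il im] /andP[jl jm] lm _].
  have s1 := sum_ord4 x u; rewrite sum_x in s1.
  have f1 := Deq i j l; have f2 := Deq i j m; have f3 := Deq j i l.
  have f4 := Deq j i m; have f5 := Deq l i m.
  rewrite ?[j == i]eq_sym ?[l == _]eq_sym ?[m == _]eq_sym in f1 f2 f3 f4 f5.
  move: (f1 ij il) (f2 ij im) (f3 ij jl) (f4 ij jm) (f5 il lm) (Dg i) (Dg j) (Dg l) (Dg m).
  move: s1; move: (x i) (x j) (x l) (x m) => a b c d s1 {}f1 {}f2 {}f3 {}f4 {}f5 ga gb gc gd.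
  have dE : d = 1 - a - b - c by rewrite s1; ring.
  apply: (Dcomb (n := 179) (DD (DB (Dnat 5 D1) (DD (DD ga gb) (DD gc gd)))
    (Dnat 30 (DD (DD (Dnat 2 f1) f2) (DD (DD f3 f4) f5))))).
  by rewrite dE; ring.
have Dsq i : D (x i ^+ 2).
  have [j ij] : exists j, i != j.
    by case: (eqVneq i ord0) => [->|]; [exists ord_max|exists ord0].
  have [l [m u]] := ord4_complete ij.
  have := u; rewrite /= !inE !negb_or => /and4P[/and3P[_ il im] _ _ _].
  have s1 := sum_ord4 x u; rewrite sum_x in s1.
  move: (Dne i j ij) (Dne i l il) (Dne i m im) (Dg i) s1.
  move: (x i) (x j) (x l) (x m) => a b c d ab ac ad ga s1.
  have dE : d = 1 - a - b - c by rewrite s1; ring.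
  apply: (Dcomb (n := 4) (DD ga (Dnat 10 (DD (DD ab ac) ad)))).
  by rewrite dE; ring.
move=> i j; have [->|] := eqVneq i j; last exact: Dne.
by rewrite -expr2.
Qed.

Local Notation p2 := (\sum_i x i ^+ 2).
Local Notation p3 := (\sum_i x i ^+ 3).

(** The hypotheses are the derivatives of the cubic bubbles along edges.  With
    c_ij = x_j^2 x_i - 3 x_i^2 x_j, the second family says that c_ij is
    independent of j modulo [D], and the fourth that products of three different
    coordinates are all congruent.  Symmetric sums are reached first, then sums
    attached to one index, then single products. *)
Lemma cubic_generation :
  (forall i, D (56 * x i ^+ 3 - 63 * x i ^+ 2 + 18 * x i)) ->
  (forall i j l, j != i -> l != i ->
     D (6 * (x i * (x j ^+ 2 - x l ^+ 2) - 3 * x i ^+ 2 * (x j - x l)))) ->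
  (forall i j, j != i ->
     D (2 * p3 - 18 * x i * p2 + 18 * x i ^+ 2 +
        6 * x i * (x i ^+ 2 - x j ^+ 2) - 18 * x i ^+ 2 * (x i - x j))) ->
  (forall i j l m, uniq [:: i; j; l; m] -> D (x i * x j * (x l - x m))) ->
  forall i j l, D (x i * x j * x l).
Proof.
move=> Dg DS DT Db.
have p2E i j l m : uniq [:: i; j; l; m] -> p2 = x i ^+ 2 + x j ^+ 2 + x l ^+ 2 + x m ^+ 2.
  exact: sum_ord4.
have p3E i j l m : uniq [:: i; j; l; m] -> p3 = x i ^+ 3 + x j ^+ 3 + x l ^+ 3 + x m ^+ 3.
  exact: sum_ord4.
have complete1 (i : 'I_4) : exists j l m, uniq [:: i; j; l; m].
  have [j ij] : exists j, i != j.
    by case: (eqVneq i ord0) => [->|]; [exists ord_max|exists ord0].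
  by have [l [m u]] := ord4_complete ij; exists j, l, m.
have uniqP (i j l m : 'I_4) : uniq [:: i; j; l; m] ->
    [/\ j != i, l != i, m != i, l != j & (m != j) && (m != l)].
  rewrite /= !inE !negb_or => /and4P[/and3P[ij il im] /andP[jl jm] lm _].
  by split; rewrite ?(eq_sym m) ?im ?jm ?lm // eq_sym.
(* The third family summed over j. *)
have T i : D (3 * p3 - 30 * x i * p2 + 36 * x i ^+ 2 - 24 * x i ^+ 3).
  have [j [l [m u]]] := complete1 i; have [ji li mi _ _] := uniqP _ _ _ _ u.
  have s1 := sum_ord4 x u; rewrite sum_x in s1.
  move: (DT i j ji) (DT i l li) (DT i m mi); rewrite (p2E _ _ _ _ u) (p3E _ _ _ _ u).
  move: s1; move: (x i) (x j) (x l) (x m) => a b c d s1 tb tc td.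
  have dE : d = 1 - a - b - c by rewrite s1; ring.
  by apply: (Dcomb (n := 1) (DD (DD tb tc) td)); rewrite dE; ring.
have [j0 [l0 [m0 u0]]] := complete1 ord0.
have s0 := sum_ord4 x u0; rewrite sum_x in s0.
have p2E0 := p2E _ _ _ _ u0; have p3E0 := p3E _ _ _ _ u0.
(* Summing T and the first family over all indices gives 6 p_2 - 12 p_3 and
   56 p_3 - 63 p_2 + 18, which with 1 determine p_2 and p_3. *)
have Dp3 : D p3.
  have := DD (DD (T ord0) (T j0)) (DD (T l0) (T m0)).
  have := DD (DD (Dg ord0) (Dg j0)) (DD (Dg l0) (Dg m0)).
  move: s0; rewrite p2E0 p3E0.
  move: (x ord0) (x j0) (x l0) (x m0) => a b c d s1 g t.
  have dE : d = 1 - a - b - c by rewrite s1; ring.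
  apply: (Dcomb (n := 139) (DB (Dnat 36 D1) (DD (Dnat 2 g) (Dnat 21 t)))).
  by rewrite dE; ring.
have Dp2 : D p2.
  have := DD (DD (T ord0) (T j0)) (DD (T l0) (T m0)); move: s0 Dp3.
  rewrite p2E0 p3E0.
  move: (x ord0) (x j0) (x l0) (x m0) => a b c d s1 q t.
  have dE : d = 1 - a - b - c by rewrite s1; ring.
  apply: (Dcomb (n := 5) (DD t (Dnat 12 q))).
  by rewrite dE; ring.
(* Expanding 1 = (x_0 + ... + x_3)^3 as p_3 + 3 (p_2 - p_3) + 6 e_3 puts the sum
   e_3 of the four congruent triple products in D. *)
have Dtriple i j l m : uniq [:: i; j; l; m] -> D (x i * x j * x l).
  move=> u; have s1 := sum_ord4 x u; rewrite sum_x in s1.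
  have := DB D1 (DD Dp3 (Dnat 3 (DB Dp2 Dp3))); rewrite (p2E _ _ _ _ u) (p3E _ _ _ _ u).
  have u1 := uniq4_swap23 u; have u2 := uniq4_swap23 (uniq4_swap12 u).
  move: (Db _ _ _ _ u) (Db _ _ _ _ u1) (Db _ _ _ _ u2) s1.
  move: (x i) (x j) (x l) (x m) => a b c d fl fj fi s1.
  have dE : d = 1 - a - b - c by rewrite s1; ring.
  move=> e3; apply: (Dcomb (n := 23) (DD e3 (Dnat 6 (DD (DD fl fj) fi)))).
  by rewrite dE; ring.
(* The element b is the sum over j <> i of x_i x_j^2.  Since c_jl is independent
   of l, three times the sum of the c_ji over j <> i is congruent to the sum of
   all c_jl with j <> i and l <> j.  There the terms x_i^2 x_j cancel, and
   8 b is congruent to 2 (p_2 - p_3). *)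
have U i : D (x i * p2 - x i ^+ 3).
  have [j [l [m u]]] := complete1 i; have [ji li mi lj /andP[mj ml]] := uniqP _ _ _ _ u.
  have s1 := sum_ord4 x u; rewrite sum_x in s1.
  have := DB Dp2 Dp3; rewrite (p2E _ _ _ _ u) (p3E _ _ _ _ u).
  have ij : i != j by rewrite eq_sym. have il : i != l by rewrite eq_sym.
  have im : i != m by rewrite eq_sym. have jl : j != l by rewrite eq_sym.
  have jm : j != m by rewrite eq_sym. have lm : l != m by rewrite eq_sym.
  move: (DD (DS j i l ij lj) (DS j i m ij mj)) (DD (DS l i j il jl) (DS l i m il ml)).
  move: (DD (DS m i j im jm) (DS m i l im lm)) s1.
  move: (x i) (x j) (x l) (x m) => a b c d fm s1 fj fl h.
  have dE : d = 1 - a - b - c by rewrite s1; ring.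
  apply: (Dcomb (n := 47) (DB (Dnat 12 h) (DD (DD fj fl) fm))).
  by rewrite dE; ring.
(* Adding twice the triple products through i to b gives x_i (1 - x_i)^2, and
   T reduces to 2 x_i^2 - 3 x_i^3; with the first family these are three
   independent combinations of x_i, x_i^2 and x_i^3. *)
have Dcube i : D (x i ^+ 3).
  have [j [l [m u]]] := complete1 i.
  have s1 := sum_ord4 x u; rewrite sum_x in s1.
  have u1 := uniq4_swap34 u; have u2 := uniq4_swap34 (uniq4_swap23 u).
  have := DB (T i) (Dnat 3 Dp3); have := Dg i; have := U i.
  rewrite (p2E _ _ _ _ u) (p3E _ _ _ _ u).
  move: (Dtriple _ _ _ _ u) (Dtriple _ _ _ _ u1) (Dtriple _ _ _ _ u2) s1.
  move: (x i) (x j) (x l) (x m) => a b c d fl fm flm s1 h g t.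
  have dE : d = 1 - a - b - c by rewrite s1; ring.
  have w := DD h (Dnat 2 (DD (DD fl fm) flm)).
  apply: (Dcomb (n := 9) (DB (DB (Dnat 72 w) (Dnat 4 g)) (Dnat 3 (DD t (Dnat 30 h))))).
  by rewrite dE; ring.
have Dsquare i : D (x i ^+ 2).
  apply: (Dcomb (n := 35)
    (DD (DD (DB (T i) (Dnat 3 Dp3)) (Dnat 30 (U i))) (Dnat 54 (Dcube i)))).
  move: p2 p3 (x i) => q2 q3 a; ring.
(* The sum of c_ij over j is b - 3 (x_i^2 - x_i^3), and its three terms are
   congruent. *)
have c_ij i j l m : uniq [:: i; j; l; m] -> D (x j ^+ 2 * x i - 3 * x i ^+ 2 * x j).
  move=> u; have [ji li mi lj /andP[mj ml]] := uniqP _ _ _ _ u.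
  have s1 := sum_ord4 x u; rewrite sum_x in s1.
  have := DB (U i) (Dnat 3 (DB (Dsquare i) (Dcube i))); rewrite (p2E _ _ _ _ u).
  move: (DS i j l ji li) (DS i j m ji mi) s1.
  move: (x i) (x j) (x l) (x m) => a b c d fl fm s1 h.
  have dE : d = 1 - a - b - c by rewrite s1; ring.
  apply: (Dcomb (n := 17) (DD (Dnat 6 h) (DD fl fm))).
  by rewrite dE; ring.
(* 3 c_ij + c_ji = - 8 x_i^2 x_j. *)
have Dmixed i j : i != j -> D (x i ^+ 2 * x j).
  move=> ij; have [l [m u]] := ord4_complete ij.
  have ji : j != i by rewrite eq_sym.
  have [l' [m' u']] := ord4_complete ji.
  apply: (Dcomb (n := 7) (DN (DD (Dnat 3 (c_ij _ _ _ _ u)) (c_ij _ _ _ _ u')))).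
  move: (x i) (x j) => a b; ring.
move=> i j l; have [->|ij] := eqVneq i j.
  have [->|jl] := eqVneq j l; first by rewrite -expr2 -exprSr.
  by rewrite -expr2; exact: Dmixed.
have [<-|jl] := eqVneq j l.
  by rewrite -mulrA -expr2 mulrC; apply: Dmixed; rewrite eq_sym.
have [<-|il] := eqVneq i l; first by rewrite mulrAC -expr2; exact: Dmixed.
have [m1 [m2 u]] := ord4_complete ij.
have : l \in [:: i; j; m1; m2].
  have [_ ->] := uniq_min_size u (s2 := enum 'I_4)
    (fun h _ => mem_enum 'I_4 h) (eq_leq (size_enum_ord 4)).
  exact: mem_enum.
rewrite !inE eq_sym (negbTE il) eq_sym (negbTE jl) /= => /orP[/eqP ->|/eqP ->].
  exact: Dtriple u.
exact: Dtriple (uniq4_swap34 u).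
Qed.

End Generation.

(** * Explicit bubbles *)
Section Bubbles.
Variable R : realType.
Variable V : 'M[R]_(4, 3).
Hypothesis hV : nondegenerate_tet V.
Local Notation P := (poly3 R).
Local Notation lam := (lam V).
Local Notation lam_monomial := (lam_monomial V).

Lemma face_integralD f p q : face_integral V f (p + q) = face_integral V f p + face_integral V f q.
Proof. by rewrite -[p in LHS]scale1r face_integral_linear// mul1r. Qed.

Lemma face_integral_natM f n p : face_integral V f (n%:R * p) = n%:R * face_integral V f p.
Proof.
by rewrite mulr_natl -scaler_nat -[_ *: _]addr0 face_integral_linear// face_integral0// addr0.
Qed.

Lemma face_integralN f p : face_integral V f (- p) = - face_integral V f p.
Proof.
by rewrite -scaleN1r -[_ *: _]addr0 face_integral_linear// face_integral0// addr0 mulN1r.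
Qed.

Lemma face_integral_sum f (F : 'I_3 -> P) :
  face_integral V f (\sum_j F j) = \sum_j face_integral V f (F j).
Proof. by rewrite !big_ord_recl !big_ord0 !face_integralD face_integral0. Qed.

Lemma face_integral_vanish f p : face_integral V f (lam f * p) = 0.
Proof.
rewrite /face_integral; under eq_Rintegral => u _.
  rewrite /peval mevalM -/(peval _ _) peval_lam_face// unlift_none mul0r; over.
rewrite Rintegral_cst ?mul0r//; exact: measurable_triangle.
Qed.

Local Notation mult s := (\prod_(j < 3) (count_mem j s)`!)%N.

Lemma face_integral_prod f (s : seq 'I_3) :
  face_integral V f (\prod_(a <- s) lam (lift f a)) = (mult s)%:R / (size s).+2`!%:R.
Proof.
have cf : count_mem f (map (lift f) s) = 0%N.
  by rewrite count_map; apply/eqP; rewrite -leqn0 leqNgt -has_count; apply/hasPn => a _ /=;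
    rewrite eq_sym neq_lift.
have cl a : count_mem (lift f a) (map (lift f) s) = count_mem a s.
  by rewrite count_map; apply: eq_count => b /=; rewrite (inj_eq lift_inj).
rewrite -(big_map (lift f) xpredT lam) prod_lam_count face_integral_monomial// cf eqxx.
congr (_%:R / _.+2`!%:R).
  rewrite (bigD1_ord f)//= cf fact0 mul1n; by apply: eq_bigr => a _; rewrite cl.
rewrite (bigD1_ord f)//= cf add0n; under eq_bigr do rewrite cl.
elim: s {cf cl} => [|b s IH] /=; first by rewrite big1.
by rewrite big_split /= IH (bigD1 b)//= eqxx big1 ?addn0// => i /negbTE; rewrite eq_sym => ->.
Qed.

(** On a face, it is enough to test against products of k - 1 of its three
    coordinates: these products span, and those involving the coordinate that
    vanishes on the face contribute nothing. *)
Lemma bubble_by_face_products k v : Pdeg k.+1 v ->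
  (forall f (s : seq 'I_3), size s = k.-1 ->
    face_integral V f (v * \prod_(a <- s) lam (lift f a)) = 0) ->
  bubble V k v.
Proof.
move=> vk h; split=> // q f qk; rewrite /integral_face.
suff -> : (\int[(@lebesgue_measure R \x @lebesgue_measure R)%E]_(u in @reference_triangle R)
    peval (v * q) (face_param V f u))%R = 0 by rewrite mulr0.
apply: (lam_span hV (D := fun q => face_integral V f (v * q) = 0) (m := k.-1)) => //.
- by rewrite mulr0 face_integral0.
- by move=> a p r p0 r0; rewrite mulrDr -scalerAr face_integral_linear// p0 r0 mulr0 addr0.
- move=> s ss; have [fs|fs] := boolP (f \in s).
    by rewrite (big_rem f)//= mulrCA face_integral_vanish.
  have [s' sE] : exists s', s = map (lift f) s'.
    elim: s fs {ss} => [|i s IH]; first by exists [::].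
    rewrite inE negb_or => /andP[fi /IH[s' ->]].
    by have [j ->|fi'] := unliftP f i; [exists (j :: s')|rewrite fi' eqxx in fi].
  by rewrite sE big_map; apply: h; rewrite -ss sE size_map.
Qed.

Lemma Pdeg_lamX i n : Pdeg n (lam i ^+ n).
Proof.
elim: n => [|n IH]; first by rewrite expr0 -mpolyC1; exact: PdegC.
by rewrite exprS -add1n; apply: Pdeg_mul => //; exact: Pdeg_lam.
Qed.

(** Under the uniform measure of a face, one coordinate t of it has density
    proportional to 1 - t, and a polynomial of degree n in the others has a
    polynomial of degree n in t as conditional mean.  So [t * psi t] is a bubble
    as soon as [psi], of degree k, is orthogonal to lower degrees for the weight
    t (1 - t).  This is the derivative of the Legendre polynomial of degree k + 1
    on the unit interval; [cubic_single] is obtained in the same way. *)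
Definition quad_single i : P := lam i * (5 * lam i ^+ 2 - 5 * lam i + 1).

(** The sum of squares makes the derivative along an edge V_j - V_l avoiding
    vertex i equal to 6 l_i (l_j - l_l); the terms in l_i alone make the moments
    on the faces vanish. *)
Definition quad_mixed i : P :=
  lam i * (3 * \sum_j lam j ^+ 2 - 6 * lam i + 5 * lam i ^+ 2).

Definition cubic_single i : P :=
  lam i * (14 * lam i ^+ 3 - 21 * lam i ^+ 2 + 9 * lam i - 1).

Definition cubic_mixed i : P :=
  lam i * (2 * \sum_j lam j ^+ 3 - 9 * lam i * \sum_j lam j ^+ 2 + 6 * lam i ^+ 2).

Definition interior_bubble : P := \prod_i lam i.

Lemma ord3_ind (Q : 'I_3 -> Prop) :
  Q ord0 -> Q (lift ord0 ord0) -> Q (lift ord0 (lift ord0 ord0)) -> forall a, Q a.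
Proof.
move=> q0 q1 q2 a; case: (unliftP ord0 a) => [b ->|-> //].
by case: (unliftP ord0 b) => [c ->|-> //]; rewrite (ord1 c).
Qed.

(** Brings the moments of monomials of different degrees over one factorial. *)
Lemma factS_inv n : (n`!%:R)^-1 = n.+1%:R / n.+1`!%:R :> R.
Proof. by rewrite factS natrM invfM mulrA divff ?mul1r// pnatr_eq0. Qed.

Lemma face_integral_prodE f (s : seq 'I_3) n : size s = n ->
  face_integral V f (\prod_(a <- s) lam (lift f a)) = (mult s)%:R / n.+2`!%:R.
Proof. by move=> <-; exact: face_integral_prod. Qed.

(** The remaining faces are those on which the factor [lam i] vanishes. *)
Lemma bubble_factor k i (w : P) : Pdeg k w ->
  (forall f a s, size s = k.-1 -> i = lift f a ->
     face_integral V f (lam i * w * \prod_(b <- s) lam (lift f b)) = 0) ->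
  bubble V k (lam i * w).
Proof.
move=> wk h; apply: bubble_by_face_products => [|f s ss].
  by rewrite -add1n; apply: Pdeg_mul => //; exact: Pdeg_lam.
case: (unliftP f i) => [a ia|->]; first exact: h ia.
by rewrite -mulrA face_integral_vanish.
Qed.

(** In this lemma and the three similar ones, [E] is the vanishing of the moments
    after multiplication by a common factorial: an identity between products of
    factorials, checked for each choice of coordinates on a face. *)
Lemma bubble_quad_single i : bubble V 2 (quad_single i).
Proof.
apply: bubble_factor => [|f a [//|c [|//]] _ ->].
  apply: PdegD; last exact: (@Pdeg_nat R _ 1).
  apply: PdegD; first by apply: Pdeg_natM; exact: Pdeg_lamX.
  by apply/PdegN/Pdeg_natM; apply: (@Pdeg_le _ 1) => //; exact: Pdeg_lam.
pose Q t : P := \prod_(b <- t) lam (lift f b).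
have key (A : comNzRingType) (x q : A) : x * (5 * x ^+ 2 - 5 * x + 1) * q =
    5%:R * (x * (x * (x * q))) + - (5%:R * (x * (x * q))) + x * q by ring.
have -> : lam (lift f a) * (5 * lam (lift f a) ^+ 2 - 5 * lam (lift f a) + 1) *
    \prod_(b <- [:: c]) lam (lift f b) =
    5%:R * Q [:: a; a; a; c] + (- (5%:R * Q [:: a; a; c])) + Q [:: a; c].
  by rewrite /Q !big_cons; exact: key.
have E : (5 * mult [:: a; a; a; c] + 30 * mult [:: a; c] = 30 * mult [:: a; a; c])%N.
  by move: a c {Q key}; do 2 apply: ord3_ind; rewrite !big_ord_recl !big_ord0.
rewrite !(face_integralD, face_integral_natM, face_integralN) /Q.
rewrite (@face_integral_prodE f [:: a; a; a; c] 4)// (@face_integral_prodE f [:: a; a; c] 3)//.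
rewrite (@face_integral_prodE f [:: a; c] 2)// (factS_inv 4) (factS_inv 5).
have : 5 * (mult [:: a; a; a; c])%:R + 30 * (mult [:: a; c])%:R =
    30 * (mult [:: a; a; c])%:R :> R by rewrite -!natrM -natrD E.
move: (mult [:: a; a; a; c])%:R (mult [:: a; a; c])%:R (mult [:: a; c])%:R (6`!%:R)^-1.
by move=> x y z w e; transitivity ((5 * x + 30 * z - 30 * y) * w);
  [ring|rewrite e subrr mul0r].
Qed.

Lemma bubble_quad_mixed i : bubble V 2 (quad_mixed i).
Proof.
apply: bubble_factor => [|f a [//|c [|//]] _ ->].
  apply: PdegD; last by apply: Pdeg_natM; exact: Pdeg_lamX.
  apply: PdegD; first by apply: Pdeg_natM; apply: Pdeg_sum => j; exact: Pdeg_lamX.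
  by apply/PdegN/Pdeg_natM; apply: (@Pdeg_le _ 1) => //; exact: Pdeg_lam.
pose Q t : P := \prod_(b <- t) lam (lift f b).
(* Here z is the coordinate that vanishes on the face, split off from the sum of
   squares. *)
have key (A : comNzRingType) (x z s q : A) :
    x * (3 * (z ^+ 2 + s) - 6 * x + 5 * x ^+ 2) * q = z * (3 * x * z * q) +
    (3%:R * (x * s * q) + - (6%:R * (x * (x * q))) + 5%:R * (x * (x * (x * q)))) by ring.
have -> : lam (lift f a) * (3 * (\sum_j lam j ^+ 2) - 6 * lam (lift f a) +
    5 * lam (lift f a) ^+ 2) * \prod_(b <- [:: c]) lam (lift f b) =
    lam f * (3 * lam (lift f a) * lam f * Q [:: c]) + (3%:R * \sum_j Q [:: a; j; j; c] +
    (- (6%:R * Q [:: a; a; c])) + 5%:R * Q [:: a; a; a; c]).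
  rewrite (bigD1_ord f)//= key; congr (_ + (3%:R * _ + _ + _)).
  - rewrite mulr_sumr mulr_suml; apply: eq_bigr => j _; rewrite /Q !big_cons.
    by rewrite expr2 -!mulrA.
  - by rewrite /Q !big_cons.
  - by rewrite /Q !big_cons.
have E : (3 * \sum_(j < 3) mult [:: a; j; j; c] + 5 * mult [:: a; a; a; c] =
    36 * mult [:: a; a; c])%N.
  by move: a c {Q key}; do 2 apply: ord3_ind; rewrite !big_ord_recl !big_ord0.
rewrite face_integralD face_integral_vanish add0r.
rewrite !(face_integralD, face_integral_natM, face_integralN, face_integral_sum) /Q.
rewrite (eq_bigr (fun j => (mult [:: a; j; j; c])%:R / 6`!%:R)) => [|j _]; last first.
  exact: face_integral_prodE.
rewrite -mulr_suml -natr_sum.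
rewrite (@face_integral_prodE f [:: a; a; a; c] 4)// (@face_integral_prodE f [:: a; a; c] 3)//.
rewrite (factS_inv 5).
have : 3 * (\sum_(j < 3) mult [:: a; j; j; c])%:R + 5 * (mult [:: a; a; a; c])%:R =
    36 * (mult [:: a; a; c])%:R :> R by rewrite -!natrM -natrD E.
move: (\sum_(j < 3) mult [:: a; j; j; c])%:R (mult [:: a; a; a; c])%:R
  (mult [:: a; a; c])%:R (6`!%:R)^-1.
by move=> x y z w e; transitivity ((3 * x + 5 * y - 36 * z) * w);
  [ring|rewrite e subrr mul0r].
Qed.

Lemma bubble_cubic_single i : bubble V 3 (cubic_single i).
Proof.
apply: bubble_factor => [|f a [//|c [//|d [|//]]] _ ->].
  apply: PdegD; last exact/PdegN/(@Pdeg_nat R _ 1).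
  apply: PdegD; last by apply: Pdeg_natM; apply: (@Pdeg_le _ 1) => //; exact: Pdeg_lam.
  apply: PdegD; first by apply: Pdeg_natM; exact: Pdeg_lamX.
  by apply/PdegN/Pdeg_natM; apply: (@Pdeg_le _ 2) => //; exact: Pdeg_lamX.
pose Q t : P := \prod_(b <- t) lam (lift f b).
have key (A : comNzRingType) (x q : A) :
    x * (14 * x ^+ 3 - 21 * x ^+ 2 + 9 * x - 1) * q =
    14%:R * (x * (x * (x * (x * q)))) + - (21%:R * (x * (x * (x * q)))) +
    9%:R * (x * (x * q)) + - (x * q) by ring.
have -> : lam (lift f a) * (14 * lam (lift f a) ^+ 3 - 21 * lam (lift f a) ^+ 2 +
    9 * lam (lift f a) - 1) * \prod_(b <- [:: c; d]) lam (lift f b) =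
    14%:R * Q [:: a; a; a; a; c; d] + (- (21%:R * Q [:: a; a; a; c; d])) +
    9%:R * Q [:: a; a; c; d] + - Q [:: a; c; d].
  by rewrite /Q !big_cons; exact: key.
have E : (14 * mult [:: a; a; a; a; c; d] + 504 * mult [:: a; a; c; d] =
    168 * mult [:: a; a; a; c; d] + 336 * mult [:: a; c; d])%N.
  by move: a c d {Q key}; do 3 apply: ord3_ind; rewrite !big_ord_recl !big_ord0.
rewrite !(face_integralD, face_integral_natM, face_integralN) /Q.
rewrite (@face_integral_prodE f [:: a; a; a; a; c; d] 6)//.
rewrite (@face_integral_prodE f [:: a; a; a; c; d] 5)//.
rewrite (@face_integral_prodE f [:: a; a; c; d] 4)// (@face_integral_prodE f [:: a; c; d] 3)//.
rewrite (factS_inv 5) (factS_inv 6) (factS_inv 7).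
have : 14 * (mult [:: a; a; a; a; c; d])%:R + 504 * (mult [:: a; a; c; d])%:R =
    168 * (mult [:: a; a; a; c; d])%:R + 336 * (mult [:: a; c; d])%:R :> R.
  by rewrite -!natrM -!natrD E.
move: (mult [:: a; a; a; a; c; d])%:R (mult [:: a; a; a; c; d])%:R
  (mult [:: a; a; c; d])%:R (mult [:: a; c; d])%:R (8`!%:R)^-1.
by move=> x y z t w e;
  transitivity ((14 * x + 504 * z - (168 * y + 336 * t)) * w);
  [ring|rewrite e subrr mul0r].
Qed.

Lemma bubble_cubic_mixed i : bubble V 3 (cubic_mixed i).
Proof.
apply: bubble_factor => [|f a [//|c [//|d [|//]]] _ ->].
  apply: PdegD; last by apply: Pdeg_natM; apply: (@Pdeg_le _ 2) => //; exact: Pdeg_lamX.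
  apply: PdegD; first by apply: Pdeg_natM; apply: Pdeg_sum => j; exact: Pdeg_lamX.
  rewrite -[3%N]/(1 + 2)%N; apply/PdegN/Pdeg_mul; first exact/Pdeg_natM/Pdeg_lam.
  by apply: Pdeg_sum => j; exact: Pdeg_lamX.
pose Q t : P := \prod_(b <- t) lam (lift f b).
have key (A : comNzRingType) (x z s2 s3 q : A) :
    x * (2 * (z ^+ 3 + s3) - 9 * x * (z ^+ 2 + s2) + 6 * x ^+ 2) * q =
    z * ((2 * x * z ^+ 2 - 9 * x ^+ 2 * z) * q) +
    (2%:R * (x * s3 * q) + - (9%:R * (x * x * s2 * q)) +
     6%:R * (x * (x * (x * q)))) by ring.
have -> : lam (lift f a) * (2 * (\sum_j lam j ^+ 3) -
    9 * lam (lift f a) * (\sum_j lam j ^+ 2) + 6 * lam (lift f a) ^+ 2) *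
    \prod_(b <- [:: c; d]) lam (lift f b) =
    lam f * ((2 * lam (lift f a) * lam f ^+ 2 - 9 * lam (lift f a) ^+ 2 * lam f) *
      Q [:: c; d]) +
    (2%:R * \sum_j Q [:: a; j; j; j; c; d] +
     (- (9%:R * \sum_j Q [:: a; a; j; j; c; d])) + 6%:R * Q [:: a; a; a; c; d]).
  rewrite (bigD1_ord f)//= [X in _ * (_ - _ * X + _) * _](bigD1_ord f)//= key.
  congr (_ + (_%:R * _ - _%:R * _ + _)).
  - rewrite mulr_sumr mulr_suml; apply: eq_bigr => j _; rewrite /Q !big_cons.
    by rewrite !exprS expr0 mulr1 -!mulrA.
  - rewrite mulr_sumr mulr_suml; apply: eq_bigr => j _; rewrite /Q !big_cons.
    by rewrite !exprS expr0 mulr1 -!mulrA.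
  - by rewrite /Q !big_cons.
have E : (2 * (\sum_(j < 3) mult [:: a; j; j; j; c; d]) + 48 * mult [:: a; a; a; c; d] =
    9 * (\sum_(j < 3) mult [:: a; a; j; j; c; d]))%N.
  by move: a c d {Q key}; do 3 apply: ord3_ind; rewrite !big_ord_recl !big_ord0.
rewrite face_integralD face_integral_vanish add0r.
rewrite !(face_integralD, face_integral_natM, face_integralN, face_integral_sum) /Q.
rewrite (eq_bigr (fun j => (mult [:: a; j; j; j; c; d])%:R / 8`!%:R)) => [|j _]; last first.
  exact: face_integral_prodE.
rewrite [in X in _ - X](eq_bigr (fun j => (mult [:: a; a; j; j; c; d])%:R / 8`!%:R)) => [|j _];
  last exact: face_integral_prodE.
rewrite -!mulr_suml -!natr_sum (@face_integral_prodE f [:: a; a; a; c; d] 5)// (factS_inv 7).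
have : 2 * (\sum_(j < 3) mult [:: a; j; j; j; c; d])%:R + 48 * (mult [:: a; a; a; c; d])%:R =
    9 * (\sum_(j < 3) mult [:: a; a; j; j; c; d])%:R :> R by rewrite -!natrM -natrD E.
move: (\sum_(j < 3) mult [:: a; j; j; j; c; d])%:R
  (\sum_(j < 3) mult [:: a; a; j; j; c; d])%:R (mult [:: a; a; a; c; d])%:R (8`!%:R)^-1.
by move=> x y z w e; transitivity ((2 * x + 48 * z - 9 * y) * w);
  [ring|rewrite e subrr mul0r].
Qed.

Lemma bubble_interior_bubble : bubble V 3 interior_bubble.
Proof.
apply: bubble_by_face_products => [|f s _].
  rewrite /interior_bubble !big_ord_recl big_ord0 mulr1 -[4%N]/(1 + (1 + (1 + 1)))%N.
  by do 3 ?[apply: Pdeg_mul]; exact: Pdeg_lam.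
by rewrite /interior_bubble (bigD1 f)//= -mulrA face_integral_vanish.
Qed.

End Bubbles.

(** * Divergences of bubble fields *)
Section Main.
Variable R : realType.
Variable V : 'M[R]_(4, 3).
Hypothesis hV : nondegenerate_tet V.
Local Notation P := (poly3 R).
Local Notation lam := (lam V).

Definition div_bubble_const k (q : P) : Prop :=
  exists v c, vbubble V k v /\ q = divergence v + c *: 1.

Lemma bubble_linear k a (p q : P) : bubble V k p -> bubble V k q -> bubble V k (a *: p + q).
Proof.
move=> pb qb; split; first by apply: Pdeg_linear; [case: pb|case: qb].
move=> r f rk; rewrite integral_faceE mulrDl -scalerAl face_integral_linear//.
by rewrite (bubble_face_integral hV f pb rk) (bubble_face_integral hV f qb rk) mulr0 addr0 mulr0.
Qed.

Lemma bubble0 k : bubble V k 0.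
Proof.
split; first by rewrite -mpolyC0; exact: PdegC.
by move=> q f _; rewrite mul0r integral_faceE face_integral0// mulr0.
Qed.

Lemma divergence_linear a (v w : 'I_3 -> P) :
  divergence (fun d => a *: v d + w d) = a *: divergence v + divergence w.
Proof.
rewrite /divergence scaler_sumr -big_split /=; apply: eq_bigr => d _.
by rewrite mderivD mderivZ.
Qed.

Lemma div_bubble_const_linear k a (p q : P) :
  div_bubble_const k p -> div_bubble_const k q -> div_bubble_const k (a *: p + q).
Proof.
move=> [v [c [vb ->]]] [w [e [wb ->]]].
exists (fun d => a *: v d + w d), (a * c + e); split.
  by move=> d; exact: bubble_linear.
by rewrite divergence_linear scalerDl scalerDr scalerA addrACA.
Qed.

Lemma div_bubble_const1 k : div_bubble_const k 1.
Proof.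
exists (fun=> 0), 1; split=> [d|]; first exact: bubble0.
by rewrite scale1r /divergence big1 ?add0r// => d _; rewrite raddf0.
Qed.

(** The divergence of b t, for a constant vector t, is the derivative of b along
    t. *)
Lemma div_bubble_const_dderiv k t b : bubble V k b -> div_bubble_const k (dderiv t b).
Proof.
move=> bb; exists (fun d => t d *: b), 0; split=> [d|].
  by rewrite -[_ *: _]addr0; apply: bubble_linear => //; exact: bubble0.
by rewrite scale0r addr0; apply: eq_bigr => d _; rewrite mderivZ.
Qed.

Lemma dderiv_quad_single t (x : P) :
  dderiv t (x * (5 * x ^+ 2 - 5 * x + 1)) = (15 * x ^+ 2 - 10 * x + 1) * dderiv t x.
Proof.
rewrite dderivM !dderivD dderivN !dderiv_natM dderivX dderiv1.
move: (dderiv t x); suff key (A : comNzRingType) (y d : A) :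
  d * (5 * y ^+ 2 - 5 * y + 1) + y * (5 * (2 * y ^+ 1 * d) - 5 * d + 0) =
  (15 * y ^+ 2 - 10 * y + 1) * d by move=> *; exact: key.
by ring.
Qed.

Lemma dderiv_quad_mixed t (x s : P) :
  dderiv t (x * (3 * s - 6 * x + 5 * x ^+ 2)) =
  dderiv t x * (3 * s - 12 * x + 15 * x ^+ 2) + 3 * x * dderiv t s.
Proof.
rewrite dderivM !dderivD dderivN !dderiv_natM dderivX.
move: (dderiv t x) (dderiv t s); suff key (A : comNzRingType) (y s' d e : A) :
  d * (3 * s' - 6 * y + 5 * y ^+ 2) + y * (3 * e - 6 * d + 5 * (2 * y ^+ 1 * d)) =
  d * (3 * s' - 12 * y + 15 * y ^+ 2) + 3 * y * e by move=> *; exact: key.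
by ring.
Qed.

Lemma dderiv_cubic_single t (x : P) :
  dderiv t (x * (14 * x ^+ 3 - 21 * x ^+ 2 + 9 * x - 1)) =
  (56 * x ^+ 3 - 63 * x ^+ 2 + 18 * x - 1) * dderiv t x.
Proof.
rewrite dderivM !dderivD !dderivN !dderiv_natM !dderivX dderiv1.
move: (dderiv t x); suff key (A : comNzRingType) (y d : A) :
  d * (14 * y ^+ 3 - 21 * y ^+ 2 + 9 * y - 1) +
  y * (14 * (3 * y ^+ 2 * d) - 21 * (2 * y ^+ 1 * d) + 9 * d - 0) =
  (56 * y ^+ 3 - 63 * y ^+ 2 + 18 * y - 1) * d by move=> *; exact: key.
by ring.
Qed.

Lemma dderiv_cubic_mixed t (x s2 s3 : P) :
  dderiv t (x * (2 * s3 - 9 * x * s2 + 6 * x ^+ 2)) =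
  dderiv t x * (2 * s3 - 18 * x * s2 + 18 * x ^+ 2) +
  x * (2 * dderiv t s3 - 9 * x * dderiv t s2).
Proof.
rewrite dderivM !dderivD dderivN (dderivM t (9 * x)) !dderiv_natM dderivX.
move: (dderiv t x) (dderiv t s2) (dderiv t s3).
suff key (A : comNzRingType) (y s t2 d e g : A) :
  d * (2 * s - 9 * y * t2 + 6 * y ^+ 2) +
  y * (2 * g - (9 * d * t2 + 9 * y * e) + 6 * (2 * y ^+ 1 * d)) =
  d * (2 * s - 18 * y * t2 + 18 * y ^+ 2) + y * (2 * g - 9 * y * e)
  by move=> *; exact: key.
by ring.
Qed.

Lemma dderiv_sum_lamX j l n :
  dderiv (edge V j l) (\sum_i lam i ^+ n.+1) = n.+1%:R * (lam j ^+ n - lam l ^+ n).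
Proof.
have -> : dderiv (edge V j l) (\sum_i lam i ^+ n.+1) =
    \sum_i dderiv (edge V j l) (lam i ^+ n.+1).
  by rewrite !big_ord_recl !big_ord0 !dderivD dderiv0.
under eq_bigr do rewrite dderivX dderiv_lam// mulrBr.
rewrite sumrB; have S h : \sum_i n.+1%:R * lam i ^+ n.+1.-1 * (h == i)%:R =
    n.+1%:R * lam h ^+ n :> P.
  rewrite (bigD1 h)//= eqxx mulr1 big1 ?addr0// => i; rewrite eq_sym => /negbTE ->.
  by rewrite mulr0.
by rewrite !S mulrBr.
Qed.

Section Generate.
Variable k : nat.
Local Notation D := (div_bubble_const k).

Lemma div_bubble_const0 : D 0.
Proof.
have := div_bubble_const_linear (-1) (div_bubble_const1 k) (div_bubble_const1 k).
by rewrite scaleN1r addNr.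
Qed.

Lemma div_bubble_constZ a p : D p -> D (a *: p).
Proof.
move=> Dp; rewrite -[_ *: _]addr0; apply: div_bubble_const_linear => //.
exact: div_bubble_const0.
Qed.

Lemma div_bubble_constB p q : D p -> D q -> D (p - q).
Proof. by move=> Dp Dq; rewrite addrC -scaleN1r; exact: div_bubble_const_linear. Qed.

Lemma div_bubble_const_natM n p : D p -> D (n%:R * p).
Proof. by move=> Dp; rewrite mulr_natl -scaler_nat; exact: div_bubble_constZ. Qed.

Lemma div_bubble_const_divn n p : D (n.+1%:R * p) -> D p.
Proof.
rewrite mulr_natl -scaler_nat => /(div_bubble_constZ n.+1%:R^-1).
by rewrite scalerA mulVf ?scale1r// pnatr_eq0.
Qed.
End Generate.

(** For the first family the edge meets vertex i, and for the second it does not;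
    the constant 1 absorbs the constant term. *)
Lemma div_bubble_const_quadratic p : Pdeg 2 p -> div_bubble_const 2 p.
Proof.
apply: (lam_span hV (div_bubble_const0 2) (@div_bubble_const_linear 2)).
suff h i j : div_bubble_const 2 (lam i * lam j).
  by move=> [|i [|j [|//]]]// _; rewrite !big_cons big_nil mulr1.
move: i j; apply: (quadratic_generation (@div_bubble_constB 2)
  (@div_bubble_const_natM 2) (@div_bubble_const_divn 2) (sum_lam hV) (div_bubble_const1 2)).
- move=> i; have [j ji] : exists j : 'I_4, j != i.
    by case: (eqVneq i ord0) => [->|]; [exists ord_max|rewrite eq_sym; exists ord0].
  have := div_bubble_constB (div_bubble_const_dderiv (edge V i j) (bubble_quad_single hV i))
    (div_bubble_const1 2).
  rewrite /quad_single dderiv_quad_single dderiv_lam// eqxx (negbTE ji) subr0 mulr1.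
  by rewrite addrK.
- move=> i j l ji li.
  have := div_bubble_const_dderiv (edge V j l) (bubble_quad_mixed hV i).
  rewrite /quad_mixed dderiv_quad_mixed dderiv_lam// (negbTE ji) (negbTE li) subrr mul0r add0r.
  rewrite (dderiv_sum_lamX j l 1) !expr1.
  suff key (A : comNzRingType) (x y : A) : 3 * x * (2 * y) = 6 * (x * y) by rewrite key.
  by ring.
Qed.

(** Edges meeting vertex i give the first and third families, and edges not
    meeting it the second; the product of all coordinates gives the fourth. *)
Lemma div_bubble_const_cubic p : Pdeg 3 p -> div_bubble_const 3 p.
Proof.
apply: (lam_span hV (div_bubble_const0 3) (@div_bubble_const_linear 3)).
suff h i j l : div_bubble_const 3 (lam i * lam j * lam l).
  by move=> [|i [|j [|l [|//]]]]// _; rewrite !big_cons big_nil mulr1 mulrA.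
move: i j l; apply: (cubic_generation (@div_bubble_constB 3)
  (@div_bubble_const_natM 3) (@div_bubble_const_divn 3) (sum_lam hV) (div_bubble_const1 3)).
- move=> i; have [j ji] : exists j : 'I_4, j != i.
    by case: (eqVneq i ord0) => [->|]; [exists ord_max|rewrite eq_sym; exists ord0].
  have := div_bubble_constB (div_bubble_const_dderiv (edge V j i) (bubble_cubic_single hV i))
    (div_bubble_const1 3).
  rewrite /cubic_single dderiv_cubic_single dderiv_lam// eqxx (negbTE ji).
  rewrite sub0r mulrN1 => /(div_bubble_constB (div_bubble_const0 3)).
  by rewrite sub0r opprD !opprK subrK.
- move=> i j l ji li.
  have := div_bubble_const_dderiv (edge V j l) (bubble_cubic_mixed hV i).
  rewrite /cubic_mixed dderiv_cubic_mixed dderiv_lam// (negbTE ji) (negbTE li).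
  rewrite subrr mul0r add0r (dderiv_sum_lamX j l 1) (dderiv_sum_lamX j l 2) !expr1.
  suff key (A : comNzRingType) (x y z : A) :
    x * (2 * (3 * y) - 9 * x * (2 * z)) = 6 * (x * y - 3 * x ^+ 2 * z) by rewrite key.
  by ring.
- move=> i j ji.
  have := div_bubble_const_dderiv (edge V i j) (bubble_cubic_mixed hV i).
  rewrite /cubic_mixed dderiv_cubic_mixed dderiv_lam// eqxx (negbTE ji).
  rewrite subr0 mul1r (dderiv_sum_lamX i j 1) (dderiv_sum_lamX i j 2) !expr1.
  suff key (A : comNzRingType) (s2 s3 x y z : A) :
    2 * s3 - 18 * x * s2 + 18 * x ^+ 2 + x * (2 * (3 * y) - 9 * x * (2 * z)) =
    2 * s3 - 18 * x * s2 + 18 * x ^+ 2 + 6 * x * y - 18 * x ^+ 2 * z by rewrite key.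
  by ring.
- move=> i j l m u.
  have E : interior_bubble V = lam i * lam j * lam l * lam m by exact: big_ord4.
  have := div_bubble_const_dderiv (edge V m l) (bubble_interior_bubble hV).
  have := u; rewrite /= !inE !negb_or => /and4P[/and3P[_ il im] /andP[jl jm] lm _].
  rewrite E 3!dderivM !dderiv_lam// !eqxx (eq_sym m l).
  rewrite ![_ == i]eq_sym ![_ == j]eq_sym.
  rewrite (negbTE il) (negbTE im) (negbTE jl) (negbTE jm) (negbTE lm).
  suff key (A : comNzRingType) (x y z w : A) :
    (((0 - 0) * y + x * (0 - 0)) * z + x * y * (0 - 1)) * w + x * y * z * (1 - 0) =
    x * y * (z - w) by rewrite key.
  by ring.
Qed.

(** Both sides of q = div v + c have integral zero except for the constant, and
    the volume is positive. *)
Lemma P0perp_divergence k q : (forall p, Pdeg k p -> div_bubble_const k p) ->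
  P0perp V k q -> exists2 v, vbubble V k v & divergence v = q.
Proof.
move=> gen [qk q0]; have [v [c [vb qE]]] := gen q qk.
exists v => //; suff c0 : c = 0 by rewrite qE c0 scale0r addr0.
have [_ v0] := divergence_P0perp hV vb.
move: q0; rewrite qE addrC integral_tet_linear// v0 addr0 => /eqP.
rewrite mulf_eq0 => /orP[/eqP//|].
have [r r0 rE] := integral_tet_monomial hV.
have := rE (fun=> 0%N); rewrite /lam_monomial big1 => [->|i _]; last by rewrite expr0.
rewrite mulf_eq0 gt_eqF//= /multifactorial big1// mulf_eq0 invr_eq0 !pnatr_eq0 /=.
by rewrite -leqn0 leqNgt fact_gt0.
Qed.

End Main.

Theorem lemma4 (R : realType) (V : 'M[R]_(4, 3)) (k : nat)
    (hV : nondegenerate_tet V) (hk : k = 2%N \/ k = 3%N) :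
  (@divergence R) @` vbubble V k = P0perp V k.
Proof.
have gen p : Pdeg k p -> div_bubble_const V k p.
  by case: hk => ->; [exact: div_bubble_const_quadratic|exact: div_bubble_const_cubic].
apply/seteqP; split=> [_ [v vb <-]|q /(P0perp_divergence hV gen)[v vb vq]].
  exact: divergence_P0perp.
by exists v.
Qed.
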